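(* Let $\mu\ge0$ and let $f(z)$ be a formal power series with real coefficients. Then $f(D)$ preserves $\mathcal{S}_\mu$, i.e. $f(D)(\mathcal{S}_\mu)\subseteq\mathcal{S}_\mu\cup\{0\}$, if and only if $f\in\mathscr{L}\text{-}\mathscr{P}$.
   Context: $D=d/dz$; for $f(z)=\sum c_kz^k$, $f(D)=\sum c_kD^k$ acting on $\mathbb{C}[z]$. $\mathcal{S}_\mu$ is the set of (nonzero) complex polynomials whose zeros all lie in $|\operatorname{Im}z|\le\mu$. The Laguerre–Pólya class $\mathscr{L}\text{-}\mathscr{P}$ is the set of real entire functions of the form $\varphi(x)=cx^me^{-ax^2+bx}\prod_{k=1}^\omega\left(1+\frac{x}{x_k}\right)e^{-x/x_k}$ ($0\le\omega\le\infty$), where $b,c,x_k\in\mathbb{R}$, $m$ is a non-negative integer, $a\ge0$, $x_k\ne0$, and $\sum_{k=1}^\omega1/x_k^2<\infty$. *)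

(* Defs.v *)
From HB Require Import structures.
From mathcomp Require Import all_boot all_order all_algebra.
From mathcomp Require Import complex.
From mathcomp Require Import all_classical all_reals all_analysis.

Set Implicit Arguments.
Unset Strict Implicit.
Unset Printing Implicit Defensive.

Import Order.TTheory GRing.Theory Num.Theory.
Import numFieldNormedType.Exports.

Local Open Scope classical_set_scope.
Local Open Scope ring_scope.
Local Open Scope complex_scope.

(* A formal power series sum_k c_k z^k with real coefficients is represented by
   its coefficient sequence c : nat -> R. *)

(* f(D) p = sum_k c_k p^(k); the terms with k >= size p vanish because
   p^`(k) = 0 there. *)
Definition series_of_D (R : realType) (c : nat -> R) (p : {poly R[i]}) :
    {poly R[i]} :=
  \sum_(0 <= k < size p) (c k)%:C *: p^`(k).

(* Nonzero constants have no zeros and belong to every S_mu. *)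
Definition strip_poly (R : realType) (mu : R) : set {poly R[i]} :=
  [set p | p != 0 /\
           forall z : R[i], root p z -> `|complex.Im z| <= mu].

Definition cexp (R : realType) (z : R[i]) : R[i] :=
  (expR (complex.Re z))%:C *
  (cos (complex.Im z) +i* sin (complex.Im z)).

Definition sums_to (R : realType) (c : nat -> R) (phi : R[i] -> R[i]) : Prop :=
  forall z : R[i],
    series (fun k => (c k)%:C * z ^+ k : R[i]^o) @ \oo --> (phi z : R[i]^o).

Definition real_entire (R : realType) (phi : R[i] -> R[i]) : Prop :=
  exists c : nat -> R, sums_to c phi.

(* The index set {k | k < omega}, with omega = None standing for infinity. *)
Definition below (omega : option nat) (k : nat) : bool :=
  if omega is Some N then (k < N)%N else true.

(* The zeros x_k are indexed from k = 0, and only the x_k with k < omega are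
   relevant. For omega finite the partial products are eventually constant. *)
Definition Laguerre_Polya (R : realType) : set (R[i] -> R[i]) :=
  [set phi | real_entire phi /\
    exists (c a b : R) (m : nat) (omega : option nat) (x : nat -> R),
      [/\ 0 <= a,
          forall k, below omega k -> x k != 0,
          cvgn (fun n => \sum_(0 <= k < n | below omega k) (x k ^+ 2)^-1 : R) &
          forall z : R[i],
            (fun n => c%:C * z ^+ m *
                      cexp (- a%:C * z ^+ 2 + b%:C * z) *
                      \prod_(0 <= k < n | below omega k)
                        ((1 + z / (x k)%:C) * cexp (- (z / (x k)%:C))) : R[i]^o)
              @ \oo --> (phi z : R[i]^o)]].

(* The formal power series c is the Taylor series at 0 of a function of the
   Laguerre-Polya class. *)
Definition in_Laguerre_Polya (R : realType) (c : nat -> R) : Prop :=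
  exists2 phi : R[i] -> R[i], Laguerre_Polya phi & sums_to c phi.

(* Main.v *)
(** If [f] is Laguerre-Polya, it is a limit, uniformly bounded on each disc, of
polynomials with real roots: the exponentials are replaced by powers
[(1 + w/N)^N]. By Cauchy's estimate the Taylor coefficients converge too. Each
real linear factor [al + be D] preserves the strip by the Gauss-Lucas argument,
and the strip is stable under coefficientwise limits.

Conversely, write [f = z^m F] with [F(0) <> 0]. Since [f(D) z^(m+N)] has its
roots in the strip, the Jensen polynomial [sum_k F_k (N^_k / N^k) z^k] equals
[F_0 prod_j (1 + al_j z)] with [|Im al_j| <= mu / N]. Its coefficients give
[sum_j al_j = F_1/F_0] and [sum_j al_j^2] bounded; as the imaginary parts are
small, [sum_j |al_j|^2] is bounded, so that the Jensen polynomials are uniformly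
bounded on discs and [F] is entire. Ordering the [al_j] by decreasing modulus and
passing to the limit along an ultrafilter gives real numbers [x_j] with
[sum_j x_j^2] finite, and the factors with large index contribute a Gaussian. *)
Require Import Defs.
From mathcomp Require Import all_boot all_order all_algebra.
From mathcomp Require Import complex.
From mathcomp Require Import all_classical all_reals all_analysis.
From mathcomp Require Import zify ring lra.

Set Implicit Arguments.
Unset Strict Implicit.
Unset Printing Implicit Defensive.

Import Order.TTheory GRing.Theory Num.Theory.
Import numFieldNormedType.Exports.

Local Open Scope classical_set_scope.
Local Open Scope ring_scope.
Local Open Scope complex_scope.

(** In the converse the width [mu] enters only through squares of imaginary parts: N numbers of size
    at most mu/N contribute mu^2/N, which is bounded and tends to 0. This is what the rescaling by N
    achieves, and why the limit class does not depend on [mu]. Sums of squares are controlled but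
    sums of moduli are not, so in both directions the estimates use factors such as (1 + w) e^(-w),
    whose first-order terms cancel and leave a bound of the form exp(C |w|^2). The inserted
    exponentials are harmless in the converse because sum al_j is fixed by the first two
    coefficients. A single ultrafilter on the degrees makes every root al_j and every value at a
    point z converge at once, in place of successive extractions of subsequences. *)

Notation nm := ComplexField.Normc.normc.

(** * Convergence in [R[i]] *)

Section ComplexLimits.
Variable R : realType.
Local Notation C := R[i].

Lemma nmE (z : C) : `|z| = (nm z)%:C. Proof. by []. Qed.

Lemma nm_ge0 (z : C) : 0 <= nm z.
Proof. by rewrite -ler0c -nmE. Qed.

Lemma nmM (x y : C) : nm (x * y) = nm x * nm y.
Proof. exact: ComplexField.Normc.normcM. Qed.

Lemma nmN (x : C) : nm (- x) = nm x.
Proof. exact: normcN. Qed.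

Lemma nmB (x y : C) : nm (x - y) = nm (y - x).
Proof. by rewrite -nmN opprB. Qed.

Lemma nmV (x : C) : nm x^-1 = (nm x)^-1.
Proof. exact: ComplexField.Normc.normcV. Qed.

Lemma nm0 : nm (0 : C) = 0. Proof. exact: ComplexField.Normc.normc0. Qed.

Lemma nm1 : nm (1 : C) = 1. Proof. exact: ComplexField.Normc.normc1. Qed.

Lemma nmX (x : C) n : nm (x ^+ n) = nm x ^+ n.
Proof. by elim: n => [|n IH]; rewrite ?nm1 // !exprS nmM IH. Qed.

Lemma nm_eq0 (x : C) : nm x = 0 -> x = 0.
Proof. exact: ComplexField.Normc.eq0_normc. Qed.

Lemma nmD (x y : C) : nm (x + y) <= nm x + nm y.
Proof. exact: le_normcD. Qed.

Lemma nm_real (x : R) : nm x%:C = `|x|.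
Proof. by rewrite /nm /= expr0n /= addr0 sqrtr_sqr. Qed.

Lemma nm_nat n : nm (n%:R : C) = n%:R.
Proof. by rewrite -(rmorph_nat (real_complex R)) nm_real ger0_norm. Qed.

Lemma nm_prod I (r : seq I) (P : pred I) (F : I -> C) :
  nm (\prod_(i <- r | P i) F i) = \prod_(i <- r | P i) nm (F i).
Proof. by elim/big_rec2: _ => [|i y x _ h]; rewrite ?nm1 // nmM h. Qed.

Lemma nm_sqr (z : C) : nm z ^+ 2 = complex.Re z ^+ 2 + complex.Im z ^+ 2.
Proof. by case: z => a b; rewrite /= sqr_sqrtr // addr_ge0 ?sqr_ge0. Qed.

Lemma Re_le_nm (z : C) : `|complex.Re z| <= nm z.
Proof.
rewrite -(ler_pXn2r (n := 2)) ?nnegrE ?nm_ge0 //.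
by rewrite nm_sqr real_normK ?num_real // lerDl sqr_ge0.
Qed.

Lemma Im_le_nm (z : C) : `|complex.Im z| <= nm z.
Proof.
rewrite -(ler_pXn2r (n := 2)) ?nnegrE ?nm_ge0 //.
by rewrite nm_sqr real_normK ?num_real // lerDr sqr_ge0.
Qed.

Lemma nm_le_ReIm (z : C) : nm z <= `|complex.Re z| + `|complex.Im z|.
Proof.
rewrite -(ler_pXn2r (n := 2)) ?nnegrE ?nm_ge0 ?addr_ge0 //.
by rewrite nm_sqr sqrrD !real_normK ?num_real // lerD2r lerDl mulrn_wge0 ?mulr_ge0.
Qed.

Lemma complexRI (z : C) : z = complex.Re z +i* complex.Im z.
Proof. by case: z. Qed.

(* The library's convergence lemmas for [R[i]^o] unify poorly with the concrete
   structure on [R[i]], hence this epsilon formulation with real norms. *)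
Definition ccvg T (F : set_system T) (u : T -> C) (l : C) : Prop :=
  forall e : R, 0 < e -> \forall t \near F, nm (u t - l) < e.

Lemma cvg_ccvgP T (F : set_system T) (FF : Filter F) (u : T -> C) (l : C) :
  u @ F --> (l : C^o) <-> ccvg F u l.
Proof.
split=> [h e e0|h].
  move/(@cvgrPdist_lt C C^o): h => /(_ e%:C); rewrite ltcR => /(_ e0).
  by apply: filterS => t; rewrite nmE ltcR nmB.
apply/(@cvgrPdist_lt C C^o) => -[e e']; rewrite ltcE /= => /andP[/eqP -> e0].
by apply: filterS (h e e0) => t; rewrite nmE ltcR nmB.
Qed.

Section Filter.
Context T (F : set_system T) {FF : Filter F}.
Implicit Types (u v : T -> C) (a b : C).

Lemma ccvg_squeeze u a (v : T -> R) :
  (\forall t \near F, nm (u t - a) <= v t) -> v @ F --> (0 : R) -> ccvg F u a.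
Proof.
move=> h /cvgrPdist_lt hv e e0.
apply: filterS2 h (hv e e0) => t h1; rewrite sub0r normrN => h2.
by apply: le_lt_trans h1 (le_lt_trans _ h2); rewrite ler_norm.
Qed.

Lemma ccvg_ext u v a : (\forall t \near F, u t = v t) -> ccvg F u a -> ccvg F v a.
Proof. by move=> h hu e e0; apply: filterS2 h (hu e e0) => t ->. Qed.

Lemma cvgr_ext (u v : T -> R) (a : R) :
  (\forall t \near F, u t = v t) -> u @ F --> a -> v @ F --> a.
Proof. by move=> h; apply: cvg_trans; apply: near_eq_cvg; apply: filterS h => t ->. Qed.

Lemma ccvg_cst a : ccvg F (fun=> a) a.
Proof. by move=> e e0; apply: nearW => t; rewrite subrr nm0. Qed.

Lemma ccvgD u v a b : ccvg F u a -> ccvg F v b -> ccvg F (fun t => u t + v t) (a + b).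
Proof.
move=> hu hv e e0; have e2 : 0 < e / 2 by rewrite divr_gt0.
apply: filterS2 (hu _ e2) (hv _ e2) => t h1 h2.
rewrite [e]splitr opprD addrACA.
by apply: le_lt_trans (nmD _ _) _; rewrite ltrD.
Qed.

Lemma ccvgM u v a b : ccvg F u a -> ccvg F v b -> ccvg F (fun t => u t * v t) (a * b).
Proof.
move=> hu hv e e0.
pose d := Num.min 1 (e / (nm a + nm b + 1)).
have ab : 0 < nm a + nm b + 1 by have := nm_ge0 a; have := nm_ge0 b; lra.
have d0 : 0 < d by rewrite lt_min ltr01 divr_gt0.
have d1 : d <= 1 by rewrite ge_min lexx.
have de : d * (nm a + nm b + 1) <= e.
  by rewrite -ler_pdivlMr // ge_min lexx orbT.
apply: filterS2 (hu _ d0) (hv _ d0) => t h1 h2.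
have -> : u t * v t - a * b = (u t - a) * (v t - b) + (a * (v t - b) + b * (u t - a)) by ring.
apply: le_lt_trans (nmD _ _) _; rewrite nmM.
apply: le_lt_trans (lerD (lexx _) (nmD _ _)) _; rewrite !nmM.
have := nm_ge0 a; have := nm_ge0 b; have := nm_ge0 (u t - a); have := nm_ge0 (v t - b).
nra.
Qed.

Lemma ccvgN u a : ccvg F u a -> ccvg F (fun t => - u t) (- a).
Proof.
by move=> h e e0; apply: filterS (h e e0) => t; rewrite -opprD nmN.
Qed.

Lemma ccvgB u v a b : ccvg F u a -> ccvg F v b -> ccvg F (fun t => u t - v t) (a - b).
Proof. by move=> hu hv; apply: ccvgD => //; apply: ccvgN. Qed.

Lemma ccvg_subr0 u a : ccvg F u a <-> ccvg F (fun t => u t - a) 0.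
Proof. by split=> h e e0; apply: filterS (h e e0) => t; rewrite subr0. Qed.

Lemma ccvg_prod I (r : seq I) (P : pred I) (w : I -> T -> C) (l : I -> C) :
  (forall i, P i -> ccvg F (w i) (l i)) ->
  ccvg F (fun t => \prod_(i <- r | P i) w i t) (\prod_(i <- r | P i) l i).
Proof.
move=> h; elim: r => [|i r IH].
  by rewrite big_nil; apply: ccvg_ext (ccvg_cst 1); apply: nearW => t; rewrite big_nil.
rewrite big_cons; case: ifPn => [Pi|Pi].
  apply: ccvg_ext (ccvgM (h i Pi) IH).
  by apply: nearW => t; rewrite big_cons Pi.
by apply: ccvg_ext IH; apply: nearW => t; rewrite big_cons (negbTE Pi).
Qed.

Lemma ccvg_sum I (r : seq I) (P : pred I) (w : I -> T -> C) (l : I -> C) :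
  (forall i, P i -> ccvg F (w i) (l i)) ->
  ccvg F (fun t => \sum_(i <- r | P i) w i t) (\sum_(i <- r | P i) l i).
Proof.
move=> h; elim: r => [|i r IH].
  by rewrite big_nil; apply: ccvg_ext (ccvg_cst 0); apply: nearW => t; rewrite big_nil.
rewrite big_cons; case: ifPn => [Pi|Pi].
  apply: ccvg_ext (ccvgD (h i Pi) IH).
  by apply: nearW => t; rewrite big_cons Pi.
by apply: ccvg_ext IH; apply: nearW => t; rewrite big_cons (negbTE Pi).
Qed.

Lemma ccvgX u a n : ccvg F u a -> ccvg F (fun t => u t ^+ n) (a ^+ n).
Proof.
move=> h; elim: n => [|n IH]; first exact: ccvg_cst.
rewrite exprS; apply: ccvg_ext (ccvgM h IH).
by apply: nearW => t; rewrite exprS.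
Qed.

Lemma ccvg_real (u : T -> R) (a : R) : u @ F --> a -> ccvg F (fun t => (u t)%:C) a%:C.
Proof.
move=> /cvgrPdist_lt h e e0; apply: filterS (h e e0) => t.
by rewrite -rmorphB nm_real distrC.
Qed.

Lemma ccvg_realP (u : T -> R) (a : R) : ccvg F (fun t => (u t)%:C) a%:C -> u @ F --> a.
Proof.
move=> h; apply/cvgrPdist_lt => e e0; apply: filterS (h e e0) => t.
by rewrite -rmorphB nm_real distrC.
Qed.

Context {PF : ProperFilter F}.

Lemma ccvg_nm_le u a (B : R) : ccvg F u a -> (\forall t \near F, nm (u t) <= B) -> nm a <= B.
Proof.
move=> h hB; apply/ler_addgt0Pr => e e0.
have [t [h1 h2]] := filter_ex (filterI (h e e0) hB).
have -> : a = u t - (u t - a) by ring.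
by apply: le_trans (nmD _ _) _; rewrite nmN lerD // ltW.
Qed.

End Filter.

End ComplexLimits.

(** * The complex exponential *)

Section ComplexExponential.
Variable R : realType.
Local Notation C := R[i].

Lemma cexp0 : cexp (0 : C) = 1.
Proof. by rewrite /cexp /= expR0 cos0 sin0 rmorph1 mul1r. Qed.

Lemma cexpD (x y : C) : cexp (x + y) = cexp x * cexp y.
Proof.
case: x => a b; case: y => c d; rewrite /cexp /= expRD cosD sinD.
by simpc; congr Complex; ring.
Qed.

Lemma cexpMn (x : C) n : cexp (x * n%:R) = cexp x ^+ n.
Proof.
elim: n => [|n IH]; first by rewrite mulr0 cexp0.
by rewrite -natr1 mulrDr mulr1 cexpD IH exprSr.
Qed.

Lemma cexp_sum I (r : seq I) (P : pred I) (f : I -> C) :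
  cexp (\sum_(i <- r | P i) f i) = \prod_(i <- r | P i) cexp (f i).
Proof.
by apply: (big_morph (@cexp R)) => [x y|]; rewrite ?cexpD ?cexp0.
Qed.

Lemma nm_cexp (z : C) : nm (cexp z) = expR (complex.Re z).
Proof.
rewrite /cexp nmM nm_real ger0_norm ?expR_ge0 //.
by rewrite /nm cos2Dsin2 sqrtr1 mulr1.
Qed.

Lemma nm_cexp_le (z : C) : nm (cexp z) <= expR (nm z).
Proof. by rewrite nm_cexp ler_expR; apply: le_trans (Re_le_nm _); apply: ler_norm. Qed.

(** Telescoping: the factors are exchanged one at a time, and the bounds exp (K i) multiply to a
    single exponential. It serves both for (1 + w/n)^n against the exponential and for Weierstrass
    factors against Gaussians. *)
Lemma nm_prod_sub (I : Type) (r : seq I) (u v : I -> C) (K : I -> R) :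
  (forall i, nm (u i) <= expR (K i)) -> (forall i, nm (v i) <= expR (K i)) ->
  (forall i, 0 <= K i) ->
  nm (\prod_(i <- r) u i - \prod_(i <- r) v i) <=
  expR (\sum_(i <- r) K i) * \sum_(i <- r) nm (u i - v i).
Proof.
move=> hu hv K0; elim: r => [|i r IH].
  by rewrite !big_nil subrr nm0 mulr0.
rewrite !big_cons expRD.
have -> : u i * \prod_(j <- r) u j - v i * \prod_(j <- r) v j =
  u i * (\prod_(j <- r) u j - \prod_(j <- r) v j) + (u i - v i) * \prod_(j <- r) v j by ring.
apply: le_trans (nmD _ _) _; rewrite !nmM.
have hp : nm (\prod_(j <- r) v j) <= expR (\sum_(j <- r) K j).
  rewrite nm_prod expR_sum; apply: ler_prod => j _.
  by rewrite nm_ge0 hv.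
rewrite mulrDr addrC; apply: lerD.
  rewrite mulrC; apply: ler_pM; rewrite ?nm_ge0 //.
  by rewrite -[leLHS]mul1r ler_pM ?ler01 ?nm_ge0 // -expR0 ler_expR.
by rewrite -mulrA; apply: ler_pM; rewrite ?nm_ge0.
Qed.

Lemma nm_1D_le (v : C) : nm (1 + v) <= expR (nm v).
Proof.
apply: le_trans (nmD _ _) _; rewrite nm1; exact: expR_ge1Dx.
Qed.

Lemma cvg_harmonic_dnbhs : (fun n : nat => n.+1%:R^-1 : R) @ \oo --> (0 : R)^'.
Proof.
move=> A; rewrite /dnbhs /within /= => h.
have hh : \forall n \near \oo, @harmonic R n != 0 -> A (harmonic n) := @cvg_harmonic R _ h.
apply: filterS hh => n; apply.
by rewrite /harmonic /= gt_eqF ?invr_gt0 ?ltr0n.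
Qed.

Lemma derive_seq (f : R -> R) (d : R) : is_derive (0 : R) 1 f d ->
  (fun n : nat => n.+1%:R * (f (n.+1%:R^-1) - f 0)) @ \oo --> d.
Proof.
case=> hf hd.
have : (fun h : R => h^-1 *: (f (h *: (1 : R) + 0) - f 0)) @ (0 : R)^' --> d by rewrite -hd; exact: hf.
move/(cvg_comp _ _ cvg_harmonic_dnbhs); apply: cvgr_ext; apply: nearW => n /=.
by rewrite invrK addr0 -[_%:R^-1 *: (1 : R)]/(_ * _) mulr1.
Qed.

Lemma ccvg_cexp_deriv (w : C) :
  ccvg \oo (fun n : nat => n.+1%:R * (cexp (w / n.+1%:R) - 1)) w.
Proof.
case: w => a b.
(* The real and imaginary parts of [cexp (w t)] for real t, with w = a + ib, are differentiated at t
   = 0. *)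
have h1 : is_derive (0 : R) 1 (fun t => expR (a * t) * cos (b * t)) a.
  by apply: is_derive_eq; rewrite /GRing.scale /=; rewrite !mulr0 expR0 cos0 sin0; ring.
have h2 : is_derive (0 : R) 1 (fun t => expR (a * t) * sin (b * t)) b.
  by apply: is_derive_eq; rewrite /GRing.scale /=; rewrite !mulr0 expR0 cos0 sin0; ring.
have {}h1 := derive_seq h1; have {}h2 := derive_seq h2.
move: h1 h2; rewrite !mulr0 expR0 cos0 sin0 mulr1 mulr0.
move=> /ccvg_real h1 /ccvg_real h2.
have h : (a +i* b) = a%:C + 'i%C * b%:C :> C by simpc.
rewrite h; apply: ccvg_ext (ccvgD h1 (ccvgM (ccvg_cst 'i%C) h2)).
apply: nearW => n; rewrite -h.
have -> : (n.+1%:R : C) = (n.+1%:R : R)%:C by rewrite rmorph_nat.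
rewrite -fmorphV /cexp /=.
by simpc; congr Complex; ring.
Qed.

(** Both sides are (n+1)-th powers, of 1 + v and [cexp v] with v = w/(n+1), so [nm_prod_sub] bounds
    the difference by e^|w| (n+1) |1 + v - cexp v|, which tends to 0 by the derivative at 0. *)
Lemma ccvg_exp_seq (w : C) :
  ccvg \oo (fun n : nat => (1 + w / n.+1%:R) ^+ n.+1) (cexp w).
Proof.
have /ccvg_subr0 h := ccvg_cexp_deriv w.
have k : (fun n : nat => expR (nm w) * nm (n.+1%:R * (cexp (w / n.+1%:R) - 1) - w)) @ \oo --> (0 : R).
  rewrite -(mulr0 (expR (nm w))); apply: cvgM; first exact: cvg_cst.
  apply/cvgrPdist_lt => e e0; apply: filterS (h e e0) => n.
  by rewrite subr0 sub0r normrN ger0_norm ?nm_ge0.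
apply: ccvg_squeeze k; apply: nearW => n.
set v := w / _.
have n0 : n.+1%:R != 0 :> C by rewrite pnatr_eq0.
have nn := @nm_nat R n.+1.
have wE : w = v * n.+1%:R by rewrite divfK.
have := @nm_prod_sub _ (iota 0 n.+1) (fun=> 1 + v) (fun=> cexp v) (fun=> nm v)
  (fun=> nm_1D_le v) (fun=> nm_cexp_le v) (fun=> nm_ge0 v).
rewrite !big_const_seq count_predT size_iota !iter_mulr_1 !iter_addr_0 -cexpMn -wE.
move/le_trans; apply.
rewrite [in leRHS]wE nmM nn !mulr_natr ler_pM2l ?expR_gt0 //.
rewrite -[X in X <= _]mulr_natl -nn -nmM -nmN le_eqVlt; apply/orP; left; apply/eqP; congr nm.
by rewrite -[v *+ _]mulr_natl; ring.
Qed.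

(** Multiplication by 1 + v reproduces the second-order expansion up to k (k - 1)/2 v^3, which gives
    the induction. For v = u/k the bound is |u|^3 e^|u|, so that the estimate survives the limit and
    becomes the expansion of [cexp]. *)
Lemma exp_seq_taylor2 (v : C) k :
  nm ((1 + v) ^+ k - 1 - k%:R * v - k%:R * (k%:R - 1) / 2 * v ^+ 2) <=
  k%:R ^+ 3 * nm v ^+ 3 * expR (k%:R * nm v).
Proof.
elim: k => [|k IH].
  by rewrite expr0 !mul0r subrr !subr0 nm0 expr0n /= mul0r mul0r.
set S := _ - _ in IH; set rhs := _ * expR _ in IH.
have -> : (1 + v) ^+ k.+1 - 1 - k.+1%:R * v - k.+1%:R * (k.+1%:R - 1) / 2 * v ^+ 2 =
  (1 + v) * S + (k * k.-1)%:R / 2%:R * v ^+ 3.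
  rewrite /S exprS; set E := (1 + v) ^+ k.
  by case: (k) => [|j]; rewrite /= natrM -?natr1 //; field.
apply: le_trans (nmD _ _) _; rewrite nmM (nmM (_ / _)) nmX nmM nmV !nm_nat.
have v0 := nm_ge0 v.
have h1 : nm (1 + v) * nm S <= expR (nm v) * rhs.
  by apply: ler_pM; rewrite ?nm_ge0 // nm_1D_le.
have e1 : expR (k.+1%:R * nm v) = expR (nm v) * expR (k%:R * nm v).
  by rewrite -expRD -natr1; congr expR; ring.
have h2 : (k * k.-1)%:R / 2 * nm v ^+ 3 <= k%:R ^+ 2 * nm v ^+ 3 * expR (k.+1%:R * nm v).
  rewrite -[leLHS]mulr1; apply: ler_pM => //.
  - by rewrite mulr_ge0 ?divr_ge0 ?exprn_ge0.
  - apply: ler_pM; rewrite ?divr_ge0 ?exprn_ge0 // ler_pdivrMr ?ltr0n //.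
    rewrite -natrX -natrM ler_nat; apply: leq_trans (_ : k * k <= _)%N.
      by rewrite leq_mul2l leq_pred orbT.
    by rewrite expnS expn1 leq_pmulr.
  - by rewrite -expR0 ler_expR mulr_ge0.
apply: le_trans (lerD h1 h2) _; rewrite /rhs e1.
have -> : expR (nm v) * (k%:R ^+ 3 * nm v ^+ 3 * expR (k%:R * nm v)) +
   k%:R ^+ 2 * nm v ^+ 3 * (expR (nm v) * expR (k%:R * nm v)) =
   (k%:R ^+ 3 + k%:R ^+ 2) * nm v ^+ 3 * (expR (nm v) * expR (k%:R * nm v)) by ring.
rewrite ler_pM2r ?mulr_gt0 ?expR_gt0 //; apply: ler_wpM2r; first by rewrite exprn_ge0.
rewrite -natr1; have : 0 <= k%:R :> R by []; nra.
Qed.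

Lemma cexp_taylor2 (u : C) :
  nm (cexp u - 1 - u - u ^+ 2 / 2) <= nm u ^+ 3 * expR (nm u).
Proof.
pose w (n : nat) := (1 + u / n.+1%:R) ^+ n.+1 - 1 - u - (1 - n.+1%:R^-1) * (u ^+ 2 / 2).
have hw : ccvg \oo w (cexp u - 1 - u - u ^+ 2 / 2).
  apply: ccvgB.
    by do 2 (apply: ccvgB; last exact: ccvg_cst); exact: ccvg_exp_seq.
  rewrite -[X in ccvg _ _ X]mul1r; apply: ccvgM; last exact: ccvg_cst.
  rewrite -[X in ccvg _ _ X]subr0; apply: ccvgB; first exact: ccvg_cst.
  apply: ccvg_ext (ccvg_real (@cvg_harmonic R)).
  by apply: nearW => n; rewrite /harmonic /= fmorphV rmorph_nat.
apply: (ccvg_nm_le hw); apply: nearW => n.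
have n0 : n.+1%:R != 0 :> C by rewrite pnatr_eq0.
have nn := @nm_nat R n.+1.
have := exp_seq_taylor2 (u / n.+1%:R) n.+1.
rewrite -nn -exprMn -!nmM (mulrC n.+1%:R) divfK // => h.
apply: le_trans h; rewrite le_eqVlt; apply/orP; left; apply/eqP; congr nm.
by rewrite /w; field.
Qed.

Lemma nm_cexp_sub1 (u : C) : nm (cexp u - 1) <= nm u * expR (nm u).
Proof.
have h n : nm ((1 + u / n.+1%:R) ^+ n.+1 - 1) <= nm u * expR (nm u).
  set v := u / _.
  have nn := @nm_nat R n.+1.
  have uE : u = v * n.+1%:R by rewrite divfK ?pnatr_eq0.
  have := @nm_prod_sub _ (iota 0 n.+1) (fun=> 1 + v) (fun=> 1) (fun=> nm v)
    (fun=> nm_1D_le v) _ (fun=> nm_ge0 v).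
  rewrite !big_const_seq count_predT size_iota !iter_mulr_1 !iter_addr_0 expr1n.
  rewrite (_ : 1 + v - 1 = v); last by ring.
  rewrite -mulr_natr -nn -nmM -uE mulrC; apply => _.
  by rewrite nm1 -expR0 ler_expR nm_ge0.
apply: (ccvg_nm_le (ccvgB (ccvg_exp_seq u) (ccvg_cst 1))).
exact: nearW.
Qed.

Lemma ccvg_cexp T (F : set_system T) (FF : Filter F) (u : T -> C) a :
  ccvg F u a -> ccvg F (fun t => cexp (u t)) (cexp a).
Proof.
move=> h e e0; pose d := Num.min 1 (e / (expR (nm a) * expR 1 + 1)).
have p : 0 < expR (nm a) * expR 1 :> R by rewrite mulr_gt0 ?expR_gt0.
have d0 : 0 < d by rewrite lt_min ltr01 divr_gt0 // addr_gt0.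
have d1 : d <= 1 by rewrite ge_min lexx.
have de : d * (expR (nm a) * expR 1 + 1) <= e.
  by rewrite -ler_pdivlMr ?addr_gt0 // ge_min lexx orbT.
apply: filterS (h _ d0) => t ht.
have -> : cexp (u t) - cexp a = cexp a * (cexp (u t - a) - 1).
  by rewrite mulrBr mulr1 -cexpD; congr (cexp _ - _); ring.
rewrite nmM.
have h1 := nm_cexp_le a; have h2 := nm_cexp_sub1 (u t - a).
have h3 : expR (nm (u t - a)) <= expR 1 by rewrite ler_expR (le_trans (ltW ht)).
have := nm_ge0 (u t - a) => h4.
apply: le_lt_trans (_ : expR (nm a) * (nm (u t - a) * expR 1) < _).
  apply: ler_pM; rewrite ?nm_ge0 //; apply: le_trans h2 _.
  by rewrite ler_wpM2l.
nra.
Qed.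

End ComplexExponential.

(** * Power series and convergence of coefficients *)

Section PowerSeries.
Variable R : realType.
Local Notation C := R[i].

(* Splitting [p] into its even and odd parts halves the degree, and square roots
   turn a bound on the circle of radius [r] into bounds for both parts on the
   circle of radius [r ^+ 2]; no contour integral is needed. *)
Lemma cauchy_estimate (p : {poly C}) (r M : R) (k : nat) : 0 < r ->
  (forall z, nm z = r -> nm p.[z] <= M) -> nm p`_k * r ^+ k <= M.
Proof.
have [n le_n] := ubnP (size p); elim: n => // n IH in p r M k le_n *.
move=> r0 hp; have r_ge0 := ltW r0.
have M0 : 0 <= M by apply: le_trans (hp r%:C _); rewrite ?nm_ge0 // nm_real ger0_norm.
have [s1|s1] := leqP (size p) 1.
  case: k => [|k]; last by rewrite nth_default ?nm0 ?mul0r // (leq_trans s1).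
  rewrite expr0 mulr1; have := hp r%:C; rewrite nm_real ger0_norm // => /(_ erefl).
  by rewrite (size1_polyC s1) hornerC coefC.
have e2 (q : {poly C}) z : (q \Po 'X^2).[z] = q.[z ^+ 2] by rewrite horner_comp hornerXn.
have pE z : p.[z] = (even_poly p).[z ^+ 2] + (odd_poly p).[z ^+ 2] * z.
  by rewrite -{1}(poly_even_odd p) hornerD hornerM hornerX !e2.
have he w : nm w = r ^+ 2 -> nm (even_poly p).[w] <= M.
  move=> hw; pose z := sqrtc w; have zz : z ^+ 2 = w := sqr_sqrtc w.
  have nz : nm z = r.
    by apply/eqP; rewrite -(eqrXn2 (n := 2)) ?nm_ge0 // -nmX zz hw.
  have := hp z nz; have := hp (- z); rewrite nmN => /(_ nz).
  rewrite !pE sqrrN zz => h1 h2.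
  set a := (even_poly p).[w] in h1 h2 *; set b := (odd_poly p).[w] in h1 h2.
  have : nm (2 * a) <= M + M.
    have -> : 2 * a = (a + b * z) + (a + b * - z) by ring.
    by apply: le_trans (nmD _ _) _; apply: lerD.
  by rewrite nmM (nm_nat _ 2); lra.
have ho w : nm w = r ^+ 2 -> nm (odd_poly p).[w] <= M / r.
  move=> hw; pose z := sqrtc w; have zz : z ^+ 2 = w := sqr_sqrtc w.
  have nz : nm z = r.
    by apply/eqP; rewrite -(eqrXn2 (n := 2)) ?nm_ge0 // -nmX zz hw.
  have := hp z nz; have := hp (- z); rewrite nmN => /(_ nz).
  rewrite !pE sqrrN zz => h1 h2.
  set a := (even_poly p).[w] in h1 h2 *; set b := (odd_poly p).[w] in h1 h2 *.
  have : nm (2 * b * z) <= M + M.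
    have -> : 2 * b * z = (a + b * z) - (a + b * - z) by ring.
    by apply: le_trans (nmD _ _) _; rewrite nmN; apply: lerD.
  by rewrite !nmM (nm_nat _ 2) nz ler_pdivlMr //; lra.
have se : (size (even_poly p) < n)%N.
  by apply: leq_ltn_trans (size_even_poly p) _; lia.
have so : (size (odd_poly p) < n)%N.
  by apply: leq_ltn_trans (size_odd_poly p) _; lia.
rewrite -(odd_double_half k); case: (odd k) => /=.
  rewrite add1n -coef_odd_poly.
  have := IH _ (r ^+ 2) (M / r) k./2 so; rewrite exprn_gt0 // => /(_ erefl ho).
  by rewrite ler_pdivlMr // -exprM mul2n -mulrA -exprSr.
rewrite add0n -coef_even_poly.
have := IH _ (r ^+ 2) M k./2 se; rewrite exprn_gt0 // => /(_ erefl he).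
by rewrite -exprM mul2n.
Qed.

Definition psum (c : nat -> R) (z : C) n : C := \sum_(0 <= k < n) (c k)%:C * z ^+ k.

Lemma sums_toP (c : nat -> R) (phi : C -> C) :
  sums_to c phi <-> forall z, ccvg \oo (psum c z) (phi z).
Proof.
split=> h z; first by apply/cvg_ccvgP; exact: h.
by apply/cvg_ccvgP; exact: h.
Qed.

Lemma sums_toB c c' (phi phi' : C -> C) : sums_to c phi -> sums_to c' phi' ->
  sums_to (fun k => c k - c' k) (fun z => phi z - phi' z).
Proof.
move=> /sums_toP h /sums_toP h'; apply/sums_toP => z.
apply: ccvg_ext (ccvgB (h z) (h' z)); apply: nearW => n.
rewrite /psum -sumrB; apply: eq_bigr => k _.
by rewrite rmorphB mulrBl.
Qed.

Lemma sums_to_poly (p : {poly R}) :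
  sums_to (fun k => p`_k) (fun z => (map_poly (real_complex R) p).[z]).
Proof.
apply/sums_toP => z; apply: ccvg_ext (ccvg_cst _); near=> n.
rewrite horner_coef size_map_poly /psum [RHS](big_cat_nat (n := size p)) //=; last first.
  by near: n; exists (size p).
rewrite [X in _ + X]big_nat_cond [X in _ + X]big1 ?addr0; last first.
  by move=> k; rewrite andbT => /andP[h _]; rewrite nth_default // mul0r.
by rewrite big_mkord; apply: eq_bigr => k _; rewrite coef_map.
Unshelve. all: by end_near.
Qed.

(** The bound is kept as a difference of geometric terms because its increment from n to n + 1 is
    exactly B / 2^n. *)
Lemma psum_tail (c : nat -> R) z B K n : (K <= n)%N ->
  (forall k, (K <= k)%N -> `|c k| * nm z ^+ k <= B / 2 ^+ k) ->
  nm (psum c z n - psum c z K) <= 2 * B * (1 / 2 ^+ K - 1 / 2 ^+ n).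
Proof.
move=> Kn hc; rewrite -(subnKC Kn); elim: (n - K)%N => [|m IH].
  by rewrite addn0 !subrr nm0 mulr0.
rewrite addnS /psum big_nat_recr //= addrAC.
apply: le_trans (nmD _ _) _; apply: le_trans (lerD IH (_ : _ <= B / 2 ^+ (K + m))) _.
  by rewrite nmM nm_real nmX hc // leq_addr.
have P0 j : (2 : R) ^+ j != 0 by rewrite expf_neq0.
by rewrite le_eqVlt; apply/orP; left; apply/eqP; rewrite exprS; field; rewrite !P0.
Qed.

Lemma sums_to_tail (c : nat -> R) phi z B K : sums_to c phi ->
  (forall k, (K <= k)%N -> `|c k| * nm z ^+ k <= B / 2 ^+ k) ->
  nm (phi z - psum c z K) <= 2 * B / 2 ^+ K.
Proof.
move=> /sums_toP h hc; apply: (ccvg_nm_le (ccvgB (h z) (ccvg_cst _))).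
near=> n; have Kn : (K <= n)%N by near: n; exists K.
apply: le_trans (psum_tail Kn hc) _.
have B0 : 0 <= B.
  have := hc K (leqnn K); rewrite ler_pdivlMr ?exprn_gt0 //; apply: le_trans.
  by rewrite !mulr_ge0 ?exprn_ge0 ?nm_ge0.
have : 0 <= 1 / 2 ^+ n :> R by rewrite divr_ge0 ?exprn_ge0.
nra.
Unshelve. all: by end_near.
Qed.

Section Families.
Context T (F : set_system T) {FF : Filter F}.

(** Nothing is assumed at 0, so the constant term is read off at a small x > 0, where the higher
    terms contribute at most B x uniformly in t. *)
Lemma coef0_cvg0 (d : T -> nat -> R) (v : T -> C -> C) (B : R) :
  (forall t, sums_to (d t) (v t)) ->
  (forall t k, `|d t k| * 2 ^+ k <= B) ->
  (forall z, z != 0 -> ccvg F (v ^~ z) 0) ->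
  d ^~ 0%N @ F --> (0 : R).
Proof.
move=> hd hB hv; apply/cvgrPdist_lt => e e0.
have [B0|B0] := ltP B 0.
  apply: nearW => t; have := hB t 0%N; rewrite expr0 mulr1.
  by have := normr_ge0 (d t 0%N); lra.
have B2 : 0 < 2 * (B + 1) by lra.
pose x := Num.min 1 (e / (2 * (B + 1))).
have x0 : 0 < x by rewrite lt_min ltr01 divr_gt0.
have x1 : x <= 1 by rewrite ge_min lexx.
have xe : x * (2 * (B + 1)) <= e.
  by rewrite -ler_pdivlMr ?ge_min ?lexx ?orbT.
have z0 : x%:C != 0 by rewrite fmorph_eq0 gt_eqF.
have e2 : 0 < e / 2 by rewrite divr_gt0.
apply: filterS (hv _ z0 _ e2) => t; rewrite subr0 => h1.
have h2 : nm (v t x%:C - (d t 0%N)%:C) <= B * x.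
  have := @sums_to_tail _ _ x%:C (B * x) 1 (hd t).
  rewrite /psum big_nat1 expr0 mulr1 expr1 (mulrC 2) mulfK //; apply => -[|j] // _.
  rewrite nm_real (ger0_norm (ltW x0)).
  rewrite ler_pdivlMr ?exprn_gt0 // mulrAC.
  apply: ler_pM; [by rewrite mulr_ge0 ?exprn_ge0|by rewrite exprn_ge0 // ltW|exact: hB|].
  by rewrite -[leRHS]mulr1 exprS ler_pM2l // exprn_ile1 // ltW.
have : `|d t 0%N| <= nm (v t x%:C) + nm (v t x%:C - (d t 0%N)%:C).
  rewrite -nm_real; have {1}-> : (d t 0%N)%:C = v t x%:C - (v t x%:C - (d t 0%N)%:C) by ring.
  by apply: le_trans (nmD _ _) _; rewrite nmN.
rewrite sub0r normrN => h3; nra.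
Qed.

(* The values are only controlled away from 0: this is what survives the division
   by [z] in the inductive step. *)
Lemma coef_cvg0 (d : T -> nat -> R) (v : T -> C -> C) (B : R) :
  (forall t, sums_to (d t) (v t)) ->
  (forall t k, `|d t k| * 2 ^+ k <= B) ->
  (forall z, z != 0 -> ccvg F (v ^~ z) 0) ->
  forall k, d ^~ k @ F --> (0 : R).
Proof.
move=> hd hB hv k; elim: k => [|k IH] in d v B hd hB hv *.
  exact: coef0_cvg0 hd hB hv.
have h0 := coef0_cvg0 hd hB hv.
(* The value at 0 is forced by the series; convergence is only asked elsewhere. *)
pose v' t (z : C) : C := if z == 0 then (d t 1%N)%:C else (v t z - (d t 0%N)%:C) / z.
apply: (IH (fun t k => d t k.+1) v' B) => [t|t j|z z0].
- apply/sums_toP => z; rewrite /v'; case: eqP => [->|/eqP z0].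
    apply: ccvg_ext (ccvg_cst _); near=> n.
    have n0 : (0 < n)%N by near: n; exists 1%N.
    rewrite /psum big_ltn // expr0 mulr1 big_nat_cond big1 ?addr0 //.
    by case=> [|i] //; rewrite expr0n /= mulr0.
  have /sums_toP/(_ z) h := hd t.
  have hs : ccvg \oo (fun n => psum (d t) z n.+1) (v t z).
    by move=> e e0; have [N _ hN] := h e e0; exists N => // n /= Nn; apply: hN; exact: leqW.
  apply: ccvg_ext (ccvgM (ccvgB hs (ccvg_cst (d t 0%N)%:C)) (ccvg_cst z^-1)).
  apply: nearW => n; rewrite /psum big_nat_recl // expr0 mulr1 addrAC subrr add0r.
  by rewrite mulr_suml; apply: eq_bigr => j _; rewrite exprSr mulrA mulfK.
- apply: le_trans (hB t j.+1); rewrite ler_wpM2l // exprS ler_peMl ?exprn_ge0 //.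
  by rewrite ler1n.
- rewrite /v' (negbTE z0) -(mul0r z^-1) -(subr0 0).
  apply: ccvgM; last exact: ccvg_cst.
  by apply: ccvgB; [exact: hv|exact: ccvg_real h0].
Unshelve. all: by end_near.
Qed.

End Families.
End PowerSeries.

(** * Operators preserving the strip *)

Section StripPreservers.
Variables (R : realType) (mu : R).
Local Notation C := R[i].
Local Notation toC := (real_complex R).
Local Notation W := (strip_poly mu `|` [set 0]).

Lemma poly_eq_away0 (p q : {poly C}) : (forall z, z != 0 -> p.[z] = q.[z]) -> p = q.
Proof.
move=> h; apply/eqP; rewrite -subr_eq0; apply: contraT => pq0.
have := @max_poly_roots _ (p - q) [seq k.+1%:R | k <- iota 0 (size (p - q))] pq0.
rewrite size_map size_iota ltnn; apply.
  by apply/allP => _ /mapP[k _ ->]; rewrite rootE hornerD hornerN h ?subrr ?pnatr_eq0.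
by rewrite map_inj_uniq ?iota_uniq // => i j /eqP; rewrite eqr_nat => /eqP [].
Qed.


Lemma series_of_D_widen (c : nat -> R) (p : {poly C}) n : (size p <= n)%N ->
  series_of_D c p = \sum_(0 <= k < n) (c k)%:C *: p^`(k).
Proof.
move=> pn; rewrite [RHS](big_cat_nat (n := size p)) //= -/(series_of_D c p).
rewrite [X in _ + X]big_nat_cond [X in _ + X]big1 ?addr0 // => k.
by rewrite andbT => /andP[pk _]; rewrite derivn_poly0 // scaler0.
Qed.

Lemma size_series_of_D (c : nat -> R) (p : {poly C}) : (size (series_of_D c p) <= size p)%N.
Proof.
apply: leq_trans (size_sum _ _ _) _; apply/bigmax_leqP_seq => k _ _.
apply: leq_trans (size_scale_leq _ _) _.
elim: k => [|k IH]; first by rewrite derivn0.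
by apply: leq_trans IH; rewrite derivnS; apply: leq_trans (size_poly _ _) (leq_pred _).
Qed.

(** The coefficients on the left are those of (al + be z) times the series: multiplying symbols
    composes operators. *)
Lemma series_of_D_linear_factor (al be : R) (c : nat -> R) (p : {poly C}) :
  series_of_D (fun k => al * c k + be * (if k is j.+1 then c j else 0)) p =
  al%:C *: series_of_D c p + be%:C *: (series_of_D c p)^`().
Proof.
rewrite (series_of_D_widen _ (leqnSn (size p))).
under eq_bigr do rewrite rmorphD scalerDl.
rewrite big_split /=; congr (_ + _).
  rewrite (series_of_D_widen c (leqnSn (size p))) scaler_sumr.
  by apply: eq_bigr => k _; rewrite rmorphM scalerA.
rewrite big_nat_recl // mulr0 scale0r add0r /series_of_D raddf_sum scaler_sumr.
by apply: eq_bigr => k _; rewrite [in RHS]/= derivZ scalerA -rmorphM -derivnS.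
Qed.

(** Im (z - a)^-1 = - Im (z - a) / |z - a|^2, and Im (z - a) has the sign of Im z because a is
    closer to the real axis. *)
Lemma Im_mul_inv_lt0 (z a : C) : `|complex.Im a| < `|complex.Im z| ->
  complex.Im z * complex.Im (z - a)^-1 < 0.
Proof.
case: z a => x y [u v] /= h.
have y0 : y != 0 by apply: contraTneq h => ->; rewrite normr0 normr_lt0.
have yv : 0 < y * (y - v).
  have : v * y <= `|v| * `|y| by rewrite -normrM ler_norm.
  have : `|v| * `|y| < y ^+ 2.
    by rewrite -real_normK ?num_real // expr2 ltr_pM2r ?normr_gt0.
  by rewrite mulrBr -expr2 (mulrC y v); lra.
rewrite mulrN oppr_lt0 mulrA mulr_gt0 // invr_gt0.
have : y - v != 0 by apply: contraTneq yv => ->; rewrite mulr0 ltxx.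
by move=> nz; rewrite ltr_wpDl ?sqr_ge0 // exprn_even_gt0.
Qed.

Lemma deriv_prod_XsubC (rs : seq C) (z : C) : (forall a, a \in rs -> z != a) ->
  (\prod_(a <- rs) ('X - a%:P))^`().[z] =
  (\prod_(a <- rs) ('X - a%:P)).[z] * \sum_(a <- rs) (z - a)^-1.
Proof.
elim: rs => [|a rs IH] h; first by rewrite !big_nil derivC horner0 mulr0.
have za : z - a != 0 by rewrite subr_eq0 h ?mem_head.
rewrite !big_cons derivM derivXsubC mul1r hornerD !hornerM IH ?hornerXsubC; last first.
  by move=> b hb; apply: h; rewrite inE hb orbT.
by field.
Qed.

(* Outside the strip all the terms of [p'/p = \sum 1/(z - a)] have imaginary
   parts of the same strict sign, so [p'/p] takes no real value there unless [p] is
   constant. *)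
Lemma strip_linear_factor (al be : R) (p : {poly C}) : W p ->
  W (al%:C *: p + be%:C *: p^`()).
Proof.
case=> [[p0 hp]|->]; last by right; rewrite deriv0 !scaler0 addr0.
have [->|q0] := eqVneq (al%:C *: p + be%:C *: p^`()) 0; first by right.
left; split=> // z; rewrite rootE hornerD !hornerZ => /eqP.
have [rs prs] := closed_field_poly_normal p.
have lc0 : lead_coef p != 0 by rewrite lead_coef_eq0.
rewrite leNgt => qz; apply/negP => zmu.
have rsmu a : a \in rs -> `|complex.Im a| < `|complex.Im z|.
  move=> ars; apply: le_lt_trans zmu; apply: hp.
  by rewrite prs rootZ // root_prod_XsubC.
have zrs a : a \in rs -> z != a.
  by move=> /rsmu; apply: contraTneq => ->; rewrite ltxx.
have pz0 : p.[z] != 0.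
  by apply: contraTN zmu => pz; rewrite -leNgt hp.
set L := \sum_(a <- rs) (z - a)^-1.
have pL : p^`().[z] = p.[z] * L.
  by rewrite prs derivZ !hornerZ deriv_prod_XsubC // mulrA.
have abL : al%:C + be%:C * L = 0.
  by apply: (mulfI pz0); rewrite mulr0 -qz pL; ring.
(* The equality case is carried along: a total imaginary part equal to 0 forces [rs] to be empty,
   hence [p] to be constant. *)
have L_le0 s : {subset s <= rs} ->
    complex.Im z * complex.Im (\sum_(a <- s) (z - a)^-1) <= 0 ?= iff (size s == 0)%N.
  elim: s => [|a s IH] hs; first by rewrite big_nil mulr0; apply/leifP; rewrite eqxx.
  have /IH [IHs _] : {subset s <= rs} by move=> b hb; apply: hs; rewrite inE hb orbT.
  have h := Im_mul_inv_lt0 (rsmu a (hs a (mem_head _ _))).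
  apply/leifP; rewrite big_cons /=.
  have -> (x y : C) : complex.Im (x + y) = complex.Im x + complex.Im y by case: x y => ? ? [].
  by rewrite mulrDr; lra.
have be0 : be != 0.
  apply: contraNneq q0 => b0; move: abL; rewrite b0 mul0r addr0 => ->.
  by rewrite !scale0r addr0.
have ImL : complex.Im L = 0.
  have := congr1 (@complex.Im R) abL.
  by case: (L) => u v /=; simpc => /eqP; rewrite mulf_eq0 (negbTE be0) => /eqP.
have [_] := L_le0 rs (fun _ h => h); rewrite ImL mulr0 eqxx => /esym/eqP/size0nil rs0.
move: abL; rewrite /L rs0 big_nil mulr0 addr0 => al0.
by move: q0; rewrite al0 scale0r add0r prs rs0 big_nil alg_polyC derivC scaler0 eqxx.
Qed.

Definition strip_preserving (c : nat -> R) : Prop := forall p, W p -> W (series_of_D c p).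

(** Stated as stability under multiplication by [A] so that products follow from associativity alone
    and only linear factors require a computation. *)
Definition strip_multiplier (A : {poly R}) : Prop :=
  forall Q : {poly R}, strip_preserving (fun k => Q`_k) -> strip_preserving (fun k => (A * Q)`_k).

Lemma strip_multiplier_linear (al be : R) : strip_multiplier (al%:P + be *: 'X).
Proof.
move=> Q hQ p Wp; rewrite (_ : (fun k => _) =
  (fun k => al * Q`_k + be * (if k is j.+1 then Q`_j else 0))).
  by rewrite series_of_D_linear_factor; apply: strip_linear_factor; exact: hQ.
apply/funext => k; rewrite mulrDl coefD mul_polyC coefZ -scalerAl coefZ coefXM.
by case: k.
Qed.

Lemma strip_multiplierM A B : strip_multiplier A -> strip_multiplier B -> strip_multiplier (A * B).
Proof. by move=> hA hB Q hQ; rewrite -mulrA; apply/hA/hB. Qed.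

Lemma strip_multiplier1 : strip_multiplier 1.
Proof. by move=> Q; rewrite mul1r. Qed.

Lemma strip_multiplierX A n : strip_multiplier A -> strip_multiplier (A ^+ n).
Proof.
move=> h; elim: n => [|n IH]; first exact: strip_multiplier1.
by rewrite exprS; apply: strip_multiplierM.
Qed.

Lemma strip_multiplier_prod I (r : seq I) (P : pred I) (A : I -> {poly R}) :
  (forall i, P i -> strip_multiplier (A i)) -> strip_multiplier (\prod_(i <- r | P i) A i).
Proof.
by move=> h; apply: big_ind => //; [exact: strip_multiplier1|exact: strip_multiplierM].
Qed.

Lemma strip_multiplier_preserving A : strip_multiplier A -> strip_preserving (fun k => A`_k).
Proof.
move=> h; rewrite -[A]mulr1; apply: h => p Wp.
have [->|p0] := eqVneq p 0.
  by right; rewrite /series_of_D size_poly0 big_geq.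
rewrite /series_of_D big_ltn ?size_poly_gt0 // big_nat_cond big1 ?addr0; last first.
  by case=> // k _; rewrite coef1 scale0r.
by rewrite coef1 scale1r derivn0.
Qed.

(** Every root a lies at distance at least |Im z| - mu from z, so |w - a| / |z - a| is at most 1 +
    |w - z| / (|Im z| - mu); there are at most d roots. This plays the part of Hurwitz's theorem in
    the passage to the limit. *)
Lemma strip_growth (q : {poly C}) d z w : W q -> (size q <= d)%N -> mu < `|complex.Im z| ->
  nm q.[w] <= nm q.[z] * (1 + nm (w - z) / (`|complex.Im z| - mu)) ^+ d.
Proof.
case=> [[q0 hq]|->] qd zmu; last by rewrite !horner0 nm0 mul0r.
have [rs qrs] := closed_field_poly_normal q.
have lc0 : lead_coef q != 0 by rewrite lead_coef_eq0.
have dl : 0 < `|complex.Im z| - mu by rewrite subr_gt0.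
set dlt := _ - mu in dl *; set K := 1 + _.
have K1 : 1 <= K by rewrite lerDl divr_ge0 ?nm_ge0 ?ltW.
have rsd : (size rs <= d)%N.
  by apply: leq_trans qd; rewrite qrs size_scale // size_prod_XsubC.
have rsmu a : a \in rs -> `|complex.Im a| <= mu.
  by move=> ars; apply: hq; rewrite qrs rootZ // root_prod_XsubC.
apply: le_trans (_ : nm q.[z] * K ^+ size rs <= _); last first.
  by rewrite ler_wpM2l ?nm_ge0 // ler_weXn2l.
rewrite qrs !hornerZ !nmM -mulrA ler_wpM2l ?nm_ge0 //.
rewrite !horner_prod !nm_prod; elim: rs rsmu {qrs rsd} => [|a rs IH] h.
  by rewrite !big_nil expr0 mulr1.
rewrite !big_cons /= exprS mulrACA; apply: ler_pM; rewrite ?nm_ge0 //.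
- by rewrite prodr_ge0 // => i _; exact: nm_ge0.
- rewrite !hornerXsubC.
  have zad : dlt <= nm (z - a).
    apply: le_trans (Im_le_nm _); have -> : complex.Im (z - a) = complex.Im z - complex.Im a.
      by case: (z) (a) => ? ? [].
    by apply: le_trans (lerB_dist _ _); rewrite lerB // h // mem_head.
  have -> : w - a = (z - a) + (w - z) by ring.
  apply: le_trans (nmD _ _) _; rewrite mulrDr mulr1 lerD2l.
  by rewrite mulrCA ler_peMr ?nm_ge0 // ler_pdivlMr // mul1r.
- by apply: IH => b hb; apply: h; rewrite inE hb orbT.
Qed.

(* A root of the limit outside the strip would, by [strip_growth], force the
   limit to vanish everywhere. *)
Lemma strip_limit T (F : set_system T) (FF : ProperFilter F) (q : T -> {poly C}) (l : {poly C}) d :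
  (forall t, W (q t)) -> (forall t, size (q t) <= d)%N ->
  (forall w, ccvg F (fun t => (q t).[w]) l.[w]) -> W l.
Proof.
move=> Wq dq ql; have [->|l0] := eqVneq l 0; first by right.
left; split=> // z lz; rewrite leNgt; apply/negP => zmu.
suff lw w : l.[w] = 0.
  by move/eqP: l0; apply; apply: poly_eq_away0 => w _; rewrite lw horner0.
apply/nm_eq0/le_anti; rewrite nm_ge0 andbT.
set K : R := (1 + nm (w - z) / (`|complex.Im z| - mu)) ^+ d.
have h : ccvg F (fun t => (q t).[z] * K%:C) 0.
  rewrite -(mul0r K%:C); apply: ccvgM; last exact: ccvg_cst.
  by rewrite -(rootP lz).
apply/ler_addgt0Pr => e e0; rewrite add0r.
apply: (ccvg_nm_le (ql w)); apply: filterS (h e e0) => t; rewrite subr0 nmM nm_real => h1.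
apply: le_trans (strip_growth w (Wq t) (dq t) zmu) _; apply: le_trans (ltW h1).
by rewrite ler_wpM2l ?nm_ge0 // ler_norm.
Qed.

Lemma strip_preserving_limit T (F : set_system T) (FF : ProperFilter F) (c : T -> nat -> R) l :
  (forall t, strip_preserving (c t)) -> (forall k, c ^~ k @ F --> l k) -> strip_preserving l.
Proof.
move=> hc cl p Wp.
apply: (@strip_limit _ _ FF (fun t => series_of_D (c t) p) _ (size p)) => [t|t|w].
- exact: hc.
- exact: size_series_of_D.
- rewrite /series_of_D horner_sum.
  apply: ccvg_ext (_ : ccvg F (fun t => \sum_(0 <= k < size p) (c t k)%:C * p^`(k).[w]) _).
    by apply: nearW => t; rewrite horner_sum; apply: eq_bigr => k _; rewrite hornerZ.
  under [X in ccvg _ _ X]eq_bigr do rewrite hornerZ.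
  by apply: ccvg_sum => k _; apply: ccvgM; [exact: ccvg_real|exact: ccvg_cst].
Qed.

End StripPreservers.

(** * Laguerre-Polya functions preserve the strip *)

Section LaguerrePolyaPreserves.
Variable R : realType.
Local Notation C := R[i].
Local Notation toC := (real_complex R).

(* "For almost all [n], for almost all [N]": limits along it are iterated limits. *)
Definition iterated_filter : set_system (nat * nat) :=
  [set A | \forall n \near \oo, \forall N \near \oo, A (n, N)].

Lemma iterated_filter_proper : ProperFilter iterated_filter.
Proof.
split.
  by case/(@filter_ex _ (nbhs \oo) _) => n /(@filter_ex _ (nbhs \oo) _)[].
split.
- by apply: nearW => n; apply: nearW.
- move=> A B; apply: (@filterS2 _ (nbhs \oo)) => n.
  exact: (@filterS2 _ (nbhs \oo)).
- move=> A B AB; apply: (@filterS _ (nbhs \oo)) => n.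
  by apply: (@filterS _ (nbhs \oo)) => N; exact: AB.
Qed.
Local Existing Instance iterated_filter_proper.

Lemma ccvg_iterated (u : nat -> C) (v : nat -> nat -> C) l : ccvg \oo u l ->
  (forall n, ccvg \oo (v n) (u n)) -> ccvg iterated_filter (fun t => v t.1 t.2) l.
Proof.
move=> ul vu e e0; have e2 : 0 < e / 2 by rewrite divr_gt0.
apply: (@filterS _ (nbhs \oo) _ _ _ _ (ul _ e2)) => n hn.
apply: filterS (vu n _ e2) => N hN /=.
have -> : v n N - l = (v n N - u n) + (u n - l) by ring.
by rewrite [e]splitr; apply: le_lt_trans (nmD _ _) _; rewrite ltrD.
Qed.

(** |1 + v|^2 = 1 + (2 Re v + |v|^2) is at most the exponential of the bracket. Keeping Re v instead
    of |v| lets it cancel against a compensating factor. *)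
Lemma nm_1D_Re (v : C) : nm (1 + v) <= expR (complex.Re v + nm v ^+ 2 / 2).
Proof.
rewrite -(ler_pXn2r (n := 2)) ?nnegrE ?nm_ge0 ?expR_ge0 //.
rewrite -expRM_natl nm_sqr; apply: le_trans (expR_ge1Dx _).
rewrite nm_sqr; case: v => x y /=; rewrite le_eqVlt; apply/orP; left; apply/eqP.
by field.
Qed.

(** Re w cancels against the compensating power, leaving the exponent |w|^2/2 (1 + 1/(N+1)). The
    bound is uniform in N and multiplies well over zeros with summable inverse squares. *)
Lemma nm_compensated_factor (w : C) N :
  nm ((1 + w) * (1 - w / N.+1%:R) ^+ N.+1) <= expR (nm w ^+ 2).
Proof.
have N0 : 0 < N.+1%:R :> R by rewrite ltr0n.
rewrite nmM nmX.
apply: le_trans (ler_pM (nm_ge0 _) (exprn_ge0 _ (nm_ge0 _)) (nm_1D_Re w)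
  (lerXn2r N.+1 _ _ (nm_1D_Re _))) _; rewrite ?nnegrE ?nm_ge0 ?expR_ge0 //.
rewrite -expRM_natl -expRD ler_expR.
rewrite nmN nmM nmV nm_nat.
have -> : complex.Re (- (w / N.+1%:R)) = - (complex.Re w / N.+1%:R).
  rewrite -(rmorph_nat toC) -fmorphV; case: (w) => x y /=; ring.
have : N.+1%:R^-1 <= 1 :> R by rewrite invf_le1 // ler1n.
have -> : complex.Re w + nm w ^+ 2 / 2 + N.+1%:R * (- (complex.Re w / N.+1%:R) + (nm w / N.+1%:R) ^+ 2 / 2) =
  nm w ^+ 2 / 2 + nm w ^+ 2 / 2 * N.+1%:R^-1 by field; rewrite gt_eqF.
move: (nm w ^+ 2) (N.+1%:R^-1) (sqr_ge0 (nm w)) => q i q0 i1.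
have := ler_wpM2l q0 i1; lra.
Qed.

Section Approximation.
Variables (c a b : R) (m : nat) (omega : option nat) (x : nat -> R).
Hypothesis a_ge0 : 0 <= a.

Definition partial_value n (z : C) : C :=
  c%:C * z ^+ m * cexp (- a%:C * z ^+ 2 + b%:C * z) *
  \prod_(0 <= k < n | below omega k) ((1 + z / (x k)%:C) * cexp (- (z / (x k)%:C))).

Definition approx_value n N (z : C) : C :=
  c%:C * z ^+ m *
  ((1 + (- a%:C * z ^+ 2) / N.+1%:R) ^+ N.+1 * (1 + b%:C * z / N.+1%:R) ^+ N.+1) *
  \prod_(0 <= k < n | below omega k)
     ((1 + z / (x k)%:C) * (1 - z / (x k)%:C / N.+1%:R) ^+ N.+1).

Definition approx_poly n N : {poly R} :=
  (c%:P + 0 *: 'X) * (0%:P + 1 *: 'X) ^+ m *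
  ((1%:P + Num.sqrt (a / N.+1%:R) *: 'X) * (1%:P + (- Num.sqrt (a / N.+1%:R)) *: 'X)) ^+ N.+1 *
  (1%:P + (b / N.+1%:R) *: 'X) ^+ N.+1 *
  \prod_(0 <= k < n | below omega k)
     ((1%:P + (x k)^-1 *: 'X) * (1%:P + (- (x k)^-1 / N.+1%:R) *: 'X) ^+ N.+1).

Lemma approx_poly_multiplier mu n N : strip_multiplier mu (approx_poly n N).
Proof.
have lin al be := @strip_multiplier_linear R mu al be.
have linX al be j := strip_multiplierX j (lin al be).
apply: strip_multiplierM; last first.
  by apply: strip_multiplier_prod => k _; exact: strip_multiplierM.
apply: strip_multiplierM => //; apply: strip_multiplierM.
  exact: strip_multiplierM.
by apply: strip_multiplierX; exact: strip_multiplierM.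
Qed.

Lemma horner_linear_factor (al be : R) z :
  (map_poly toC (al%:P + be *: 'X)).[z] = al%:C + be%:C * z.
Proof. by rewrite rmorphD /= map_polyC map_polyZ map_polyX hornerD hornerC hornerZ hornerX. Qed.

Lemma approx_polyE n N z : (map_poly toC (approx_poly n N)).[z] = approx_value n N z.
Proof.
rewrite /approx_poly /approx_value !rmorphM !rmorphXn rmorphM rmorph_prod.
rewrite !hornerM !horner_exp hornerM !horner_linear_factor horner_prod.
rewrite -!mulrA; congr (_ * _); first by rewrite mul0r addr0.
congr (_ * _); first by rewrite add0r mul1r.
congr (_ * _).
  congr (_ ^+ _).
  have E : a%:C / N.+1%:R = (Num.sqrt (a / N.+1%:R))%:C ^+ 2 :> C.
    by rewrite -rmorphXn /= sqr_sqrtr ?divr_ge0 // rmorphM fmorphV rmorph_nat.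
  transitivity (1 - (a%:C / N.+1%:R) * z ^+ 2); last by ring.
  by rewrite E rmorphN; ring.
congr (_ * _).
  by congr ((1 + _) ^+ _); rewrite rmorphM fmorphV rmorph_nat; ring.
apply: eq_bigr => k _; rewrite rmorphM rmorphXn hornerM horner_exp !horner_linear_factor.
rewrite rmorphM rmorphN !fmorphV rmorph_nat.
by congr (_ * _); [congr (_ + _); ring|congr (_ ^+ _); ring].
Qed.

Lemma ccvg_approx n z : ccvg \oo (fun N => approx_value n N z) (partial_value n z).
Proof.
apply: ccvgM.
  apply: ccvgM; first exact: ccvg_cst.
  by rewrite cexpD; apply: ccvgM; exact: ccvg_exp_seq.
apply: ccvg_prod => k _; apply: ccvgM; first exact: ccvg_cst.
apply: ccvg_ext (ccvg_exp_seq _); apply: nearW => N.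
by rewrite mulNr.
Qed.

Lemma approx_bound (S : R) n N z :
  (\sum_(0 <= k < n | below omega k) (x k ^+ 2)^-1 <= S) ->
  nm (approx_value n N z) <=
  `|c| * nm z ^+ m * (expR (a * nm z ^+ 2) * expR (`|b| * nm z)) * expR (nm z ^+ 2 * S).
Proof.
move=> hS; rewrite /approx_value nmM nmM nmM nm_real nmX.
have N0 : N.+1%:R != 0 :> R by rewrite pnatr_eq0.
have pow (w : C) : nm ((1 + w / N.+1%:R) ^+ N.+1) <= expR (nm w).
  rewrite nmX; apply: le_trans (lerXn2r N.+1 _ _ (nm_1D_le _)) _;
    rewrite ?nnegrE ?nm_ge0 ?expR_ge0 //.
  by rewrite -expRM_natl nmM nmV nm_nat mulrC divfK.
apply: ler_pM; rewrite ?mulr_ge0 ?exprn_ge0 ?nm_ge0 //.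
  apply: ler_wpM2l; first by rewrite mulr_ge0 ?exprn_ge0 ?nm_ge0.
  rewrite nmM; apply: ler_pM; rewrite ?nm_ge0 //.
    by apply: le_trans (pow _) _; rewrite nmM nmN nmX nm_real ger0_norm.
  by apply: le_trans (pow _) _; rewrite nmM nm_real.
rewrite nm_prod; apply: le_trans (_ : \prod_(0 <= k < n | below omega k) expR (nm z ^+ 2 * (x k ^+ 2)^-1) <= _).
  apply: ler_prod => k _; rewrite nm_ge0 /=; apply: le_trans (nm_compensated_factor _ _) _.
  by rewrite nmM nmV nm_real exprMn exprVn real_normK ?num_real.
rewrite -expR_sum ler_expR -mulr_sumr; apply: ler_wpM2l => //.
by rewrite exprn_ge0 ?nm_ge0.
Qed.

End Approximation.

Lemma sums_to_bounded (c : nat -> R) phi (r : R) : 0 < r -> sums_to c phi ->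
  exists B, forall k, `|c k| * r ^+ k <= B.
Proof.
move=> r0 /sums_toP/(_ r%:C) h.
(* From this rank on, consecutive partial sums differ by at most 1, which bounds the terms. *)
have [N _ hN] := h (1 / 2) (divr_gt0 ltr01 (ltr0Sn _ 1)).
exists (\sum_(k < N) `|c k| * r ^+ k + 1) => k.
have S0 (P : pred 'I_N) : 0 <= \sum_(k < N | P k) `|c k| * r ^+ k.
  by apply: sumr_ge0 => i _; rewrite mulr_ge0 ?exprn_ge0 // ltW.
have [kN|Nk] := ltnP k N.
  rewrite (bigD1 (Ordinal kN)) //= -addrA lerDl addr_ge0 // S0.
apply: (@le_trans _ _ 1); last by rewrite lerDr S0.
have -> : `|c k| * r ^+ k = nm (psum c r%:C k.+1 - psum c r%:C k).
  rewrite /psum big_nat_recr //= addrAC subrr add0r nmM nmX !nm_real.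
  by rewrite (ger0_norm (ltW r0)).
have -> : psum c r%:C k.+1 - psum c r%:C k =
  (psum c r%:C k.+1 - phi r%:C) - (psum c r%:C k - phi r%:C) by ring.
apply: le_trans (nmD _ _) _; rewrite nmN [leRHS]splitr.
by apply: lerD; apply: ltW; apply: hN => //=; exact: leqW.
Qed.

Lemma Laguerre_Polya_preserves (mu : R) (f : nat -> R) :
  in_Laguerre_Polya f -> strip_preserving mu f.
Proof.
case=> phi [_ [c [a [b [m [omega [x [a0 x0 xS hphi]]]]]]]] hf.
have [S hS] : exists S, forall n, \sum_(0 <= k < n | below omega k) (x k ^+ 2)^-1 <= S.
  exists (limn (fun n => \sum_(0 <= k < n | below omega k) (x k ^+ 2)^-1)) => n.
  apply: nondecreasing_cvgn_le => // p q pq.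
  rewrite [leRHS](big_cat_nat (n := p)) //= lerDl sumr_ge0 // => k _.
  by rewrite invr_ge0 sqr_ge0.
pose P (t : nat * nat) := approx_poly c a b m omega x t.1 t.2.
have [Bf hBf] := sums_to_bounded (ltr0Sn _ 1) hf.
(* A bound on the circle |z| = 2: Cauchy's estimate turns it into the factor 2^k demanded by
   [coef_cvg0]. *)
pose BP : R := `|c| * 2 ^+ m * (expR (a * 2 ^+ 2) * expR (`|b| * 2)) * expR (2 ^+ 2 * S).
have Ppres t : strip_preserving mu (fun k => (P t)`_k).
  exact/strip_multiplier_preserving/approx_poly_multiplier.
have PE t z : (map_poly toC (P t)).[z] = approx_value c a b m omega x t.1 t.2 z.
  exact: approx_polyE.
have PB t k : `|(P t)`_k| * 2 ^+ k <= BP.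
  rewrite -nm_real -coef_map; apply: cauchy_estimate => // z zr.
  by rewrite PE /BP -zr; apply: approx_bound.
clearbody P BP.
have h k : (fun t => (P t)`_k - f k) @ iterated_filter --> (0 : R).
  apply: (@coef_cvg0 _ _ iterated_filter _ (fun t k => (P t)`_k - f k)
    (fun t z => (map_poly toC (P t)).[z] - phi z) (BP + Bf)) => [t|t j|z _].
  - exact: (sums_toB (@sums_to_poly _ (P t)) hf).
  - have := PB t j; have := hBf j; move: ((P t)`_j) (f j) => p q h1 h2.
    have p2 : 0 <= 2 ^+ j :> R by rewrite exprn_ge0.
    by have := ler_wpM2r p2 (ler_normB p q); rewrite mulrDl; lra.
  - have ul : ccvg \oo (fun n => partial_value c a b m omega x n z) (phi z).
      by apply/cvg_ccvgP; exact: hphi.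
    have vl := ccvg_iterated ul (fun n => ccvg_approx c a b m omega x n z).
    have {}vl : ccvg iterated_filter (fun t => (map_poly toC (P t)).[z]) (phi z).
      by apply: ccvg_ext vl; apply: nearW => t; rewrite PE.
    by move/ccvg_subr0: vl.
apply: (@strip_preserving_limit _ _ _ iterated_filter _ (fun t k => (P t)`_k)) => // k.
have hk : (fun t => (P t)`_k - f k + f k) @ iterated_filter --> 0 + f k.
  exact: (cvgD (h k) (cvg_cst (f k))).
rewrite add0r in hk; apply: cvgr_ext hk.
by apply: nearW => t; rewrite subrK.
Qed.

End LaguerrePolyaPreserves.

(** * Jensen polynomials of a strip-preserving series *)

Section JensenPolynomials.
Variable R : realType.
Local Notation C := R[i].
Local Notation toC := (real_complex R).

Lemma ffactnD m N j : ((m + N) ^_ (m + j) = (m + N) ^_ m * N ^_ j)%N.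
Proof.
elim: j => [|j IH]; first by rewrite addn0 ffactn0 muln1.
by rewrite addnS !ffactnSr IH subnDl mulnA.
Qed.

(* With [f = z^m F], this is [f(D) z^(m+N)] up to a constant factor, read
   backwards and rescaled by [N]; its coefficients tend to those of [F]. *)
Definition jensen (F : nat -> R) N : {poly R} :=
  \poly_(k < N.+1) (F k * (N ^_ k)%:R / N%:R ^+ k).

Lemma series_of_D_Xn (f : nat -> R) m N : (forall k, (k < m)%N -> f k = 0) ->
  series_of_D f 'X^(m + N) = ((m + N) ^_ m)%:R *:
    \poly_(i < N.+1) (f (m + (N - i))%N * (N ^_ (N - i))%:R)%:C.
Proof.
move=> f0; rewrite /series_of_D size_polyXn (big_cat_nat (n := m)) //=; last first.
  by rewrite -addnS leq_addr.
rewrite big_nat_cond big1 ?add0r => [|k]; last first.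
  by rewrite andbT => /andP[_ km]; rewrite f0 // scale0r.
rewrite -[in X in \sum_(X <= _ < _) _](add0n m) -addnS big_addn addKn big_mkord.
rewrite poly_def scaler_sumr [RHS](reindex_inj rev_ord_inj) /=.
apply: eq_bigr => j _; have jN : (j <= N)%N by rewrite -ltnS.
rewrite subSS subKn // derivnXn addnC ffactnD subnDl.
rewrite rmorphM rmorph_nat scalerA -scaler_nat scalerA natrM.
by congr (_ *: _); ring.
Qed.

(** The reversed polynomial [r] has leading coefficient f m <> 0, hence exactly N = M+1 roots, and a
    root z becomes the factor 1 - (z/N) X. A drop in the degree of the Jensen polynomial shows up as
    roots z = 0, that is, as trivial factors. *)
Lemma jensen_roots (mu : R) (f : nat -> R) m M :
  (strip_poly mu `|` [set 0]) (series_of_D f ('X^(m + M.+1) : {poly C})) ->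
  (forall k, (k < m)%N -> f k = 0) -> f m != 0 ->
  exists al : seq C, [/\ size al = M.+1,
    forall a, a \in al -> `|complex.Im a| <= mu / M.+1%:R &
    map_poly toC (jensen (fun k => f (m + k)%N) M.+1) =
      (f m)%:C *: \prod_(a <- al) (1 + a *: 'X)].
Proof.
set N := M.+1 => hW f0 fm.
pose r : {poly C} := \poly_(i < N.+1) (f (m + (N - i))%N * (N ^_ (N - i))%:R)%:C.
have N0 : N%:R != 0 :> C by rewrite pnatr_eq0.
have ff0 : ((m + N) ^_ m)%:R != 0 :> C by rewrite pnatr_eq0 -lt0n ffact_gt0 leq_addr.
have lr : (f (m + (N - N))%N * (N ^_ (N - N))%:R)%:C = (f m)%:C :> C.
  by rewrite subnn addn0 ffactn0 mulr1.
have fmC : (f m)%:C != 0 :> C by rewrite fmorph_eq0.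
have sr : size r = N.+1 by rewrite size_poly_eq //= lr.
have ldr : lead_coef r = (f m)%:C by rewrite lead_coef_poly //= lr.
have r0 : r != 0 by rewrite -size_poly_gt0 sr.
have rroot z : root r z -> `|complex.Im z| <= mu.
  move=> rz; case: hW; rewrite series_of_D_Xn // -/r.
    by case=> _; apply; rewrite rootZ.
  by move/eqP; rewrite scaler_eq0 (negbTE ff0) (negbTE r0).
have [rs rrs] := closed_field_poly_normal r.
have srs : size rs = N.
  by have := sr; rewrite rrs size_scale ?size_prod_XsubC ?ldr // => -[].
exists [seq - (z / N%:R) | z <- rs]; split; first by rewrite size_map.
- move=> _ /mapP[z zrs ->].
  have -> : complex.Im (- (z / N%:R)) = - (complex.Im z / N%:R).
    by rewrite -(rmorph_nat toC) -fmorphV; case: (z) => x y /=; ring.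
  rewrite normrN normrM [X in _ * X]ger0_norm ?invr_ge0 // ler_wpM2r ?invr_ge0 //.
  by apply: rroot; rewrite rrs rootZ ?ldr // root_prod_XsubC.
(* Reversal evaluates [r] at N/z, hence the comparison at nonzero z. *)
apply: poly_eq_away0 => z z0.
have : r.[N%:R / z] * (z / N%:R) ^+ N = (f m)%:C * \prod_(a <- rs) (1 - a / N%:R * z).
  rewrite rrs ldr hornerZ -mulrA; congr (_ * _).
  rewrite horner_prod -[X in _ ^+ X]srs; elim: (rs) => [|a s IH]; first by rewrite !big_nil mulr1.
  rewrite !big_cons exprS mulrACA IH hornerXsubC; congr (_ * _).
  by field; rewrite N0 z0.
move=> E; rewrite hornerZ horner_prod big_map.
under [in RHS]eq_bigr do rewrite hornerD hornerC hornerZ hornerX mulNr.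
rewrite -E (@horner_coef_wide _ N.+1); last first.
  by rewrite size_map_poly size_poly.
rewrite /r horner_poly mulr_suml [RHS](reindex_inj rev_ord_inj) /=.
apply: eq_bigr => j _; have jN : (j <= N)%N by rewrite -ltnS.
rewrite coef_map coef_poly ltn_ord subSS subKn //=.
have -> : (z / N%:R) ^+ N = (z / N%:R) ^+ (N - j) * (z / N%:R) ^+ j by rewrite -exprD subnK.
have e1 : (N%:R / z) ^+ (N - j) * (z / N%:R) ^+ (N - j) = 1.
  by rewrite -exprMn mulrA divfK // divff // expr1n.
rewrite -[RHS]mulrA (mulrA (_ ^+ (N - j))) e1 mul1r expr_div_n.
by rewrite !rmorphM fmorphV !rmorphXn !rmorph_nat; ring.
Qed.

(** Newton's identities up to degree two, which turn coefficients of Jensen polynomials into power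
    sums of the al_j. *)
Lemma coef_prod_linear (al : seq C) :
  [/\ (\prod_(a <- al) (1 + a *: 'X))`_0 = 1,
      (\prod_(a <- al) (1 + a *: 'X))`_1 = \sum_(a <- al) a &
      2 * (\prod_(a <- al) (1 + a *: 'X))`_2 =
        (\sum_(a <- al) a) ^+ 2 - \sum_(a <- al) a ^+ 2].
Proof.
elim: al => [|a al [h0 h1 h2]].
  by rewrite !big_nil !coef1 /=; split=> //; ring.
rewrite !big_cons; move: (\prod_(b <- al) _) h0 h1 h2 => P h0 h1 h2.
have e k : ((1 + a *: 'X) * P)`_k = P`_k + a * (if k == 0%N then 0 else P`_k.-1).
  by rewrite mulrDl mul1r coefD -scalerAl coefZ coefXM.
rewrite !e /= h0 h1; split; [by rewrite mulr0 addr0|by rewrite mulr1 addrC|].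
by rewrite mulrDr h2; ring.
Qed.

End JensenPolynomials.

(** * Limits of bounded families along an ultrafilter *)

Section UltrafilterLimits.
Variable R : realType.
Local Notation C := R[i].

Lemma ultra_fmap T S (U : set_system T) (UU : UltraFilter U) (f : T -> S) :
  UltraFilter (f @ U).
Proof.
apply: Build_UltraFilter => G PG sUG; apply/seteqP; split=> // A GA.
have [//|nA] := in_ultra_setVsetC (f @^-1` A) UU.
have GnA : G (~` A) by apply: sUG.
by have [y [Ay]] := filter_ex (filterI GA GnA); case.
Qed.

Lemma ultra_cvg_real T (U : set_system T) (UU : UltraFilter U) (u : T -> R) (B : R) :
  (forall t, `|u t| <= B) -> exists l : R, u @ U --> l.
Proof.
move=> uB; have : compact `[- B, B] by exact: segment_compact.
rewrite compact_ultra => /(_ (u @ U) (ultra_fmap UU u)) [|l [_ ul]]; last by exists l.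
have : \forall t \near U, `[- B, B]%classic (u t).
  by apply: nearW => t; rewrite /= in_itv /= -ler_norml.
exact.
Qed.

Lemma ultra_cvg_complex T (U : set_system T) (UU : UltraFilter U) (u : T -> C) (B : R) :
  (forall t, nm (u t) <= B) -> exists l : C, ccvg U u l.
Proof.
move=> uB.
have [x ux] : exists x : R, (fun t => complex.Re (u t)) @ U --> x.
  by apply: (@ultra_cvg_real _ _ UU _ B) => t; apply: le_trans (Re_le_nm _) (uB t).
have [y uy] : exists y : R, (fun t => complex.Im (u t)) @ U --> y.
  by apply: (@ultra_cvg_real _ _ UU _ B) => t; apply: le_trans (Im_le_nm _) (uB t).
exists (x%:C + 'i%C * y%:C).
apply: ccvg_ext (ccvgD (ccvg_real ux) (ccvgM (ccvg_cst 'i%C) (ccvg_real uy))).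
by apply: nearW => t; rewrite [RHS]complexRI; simpc.
Qed.

End UltrafilterLimits.

(** * Weierstrass factors of genus one and their Gaussian approximation *)

Section GenusOneFactor.
Variable R : realType.
Local Notation C := R[i].

(** The elementary factor E_1(-w), where E_1(u) = (1 - u) e^u. *)
Definition weierstrass_factor (w : C) : C := (1 + w) * cexp (- w).

Lemma nm_weierstrass_factor (w : C) : nm (weierstrass_factor w) <= expR (nm w ^+ 2 / 2).
Proof.
rewrite nmM nm_cexp.
apply: le_trans (ler_wpM2r (expR_ge0 _) (nm_1D_Re w)) _.
have -> : complex.Re (- w) = - complex.Re w by case: w.
by rewrite -expRD ler_expR; lra.
Qed.

(** The same bound as for the Weierstrass factor, since [nm_prod_sub] compares two products under
    common bounds. *)
Lemma nm_gaussian (w : C) : nm (cexp (- (w ^+ 2 / 2))) <= expR (nm w ^+ 2 / 2).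
Proof.
apply: le_trans (nm_cexp_le _) _.
by rewrite nmN nmM nmX nmV nm_nat.
Qed.

Lemma weierstrass_factor_gaussian (w : C) : nm w <= 1 ->
  nm (weierstrass_factor w - cexp (- (w ^+ 2 / 2))) <=
  expR 1 * (8 * expR 2 + 1) * nm w ^+ 3.
Proof.
move=> w1; have w0 := nm_ge0 w.
pose u := w - w ^+ 2 / 2.
have uw : nm u <= 2 * nm w.
  apply: le_trans (nmD _ _) _; rewrite nmN nmM nmX nmV nm_nat; nra.
have -> : weierstrass_factor w - cexp (- (w ^+ 2 / 2)) = cexp (- w) * (1 + w - cexp u).
  rewrite /weierstrass_factor mulrBr -cexpD mulrC; congr (_ - cexp _); rewrite /u; ring.
rewrite nmM -mulrA; apply: ler_pM; rewrite ?nm_ge0 //.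
  by apply: le_trans (nm_cexp_le _) _; rewrite nmN ler_expR.
(* [u] is the second-order expansion of log (1 + w), and 1 + u + u^2/2 = 1 + w - w^3/2 + w^4/8. In
   the final constant, 8 and [expR 2] come from |u| <= 2 |w|, and the summand 1 absorbs 1/2 +
   1/8. *)
have -> : 1 + w - cexp u = - (cexp u - 1 - u - u ^+ 2 / 2) + (w ^+ 3 / 2 - w ^+ 4 / 8%:R).
  by rewrite /u; field.
apply: le_trans (nmD _ _) _; rewrite nmN mulrDl mul1r; apply: lerD.
  apply: le_trans (cexp_taylor2 u) _.
  have u3 : nm u ^+ 3 <= (2 * nm w) ^+ 3 by rewrite lerXn2r ?nnegrE ?nm_ge0 ?mulr_ge0.
  have e2 : expR (nm u) <= expR 2 by rewrite ler_expR; lra.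
  rewrite -mulrA (mulrC (expR 2)) mulrA; apply: ler_pM; rewrite ?expR_ge0 ?exprn_ge0 ?nm_ge0 //.
  by rewrite (le_trans u3) // exprMn; apply: ler_wpM2r; rewrite ?exprn_ge0 //; lra.
apply: le_trans (nmD _ _) _; rewrite nmN (nmM (_ ^+ 3)) (nmM (_ ^+ 4)) !nmX !nmV !nm_nat.
have : 0 <= nm w ^+ 3 by rewrite exprn_ge0.
by rewrite (exprS _ 3); nra.
Qed.

Lemma ccvg_weierstrass_factor T (F : set_system T) (FF : Filter F) (u : T -> C) a :
  ccvg F u a -> ccvg F (fun t => weierstrass_factor (u t)) (weierstrass_factor a).
Proof.
move=> h; apply: ccvgM; first by apply: ccvgD => //; exact: ccvg_cst.
by apply: ccvg_cexp; exact: ccvgN.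
Qed.

End GenusOneFactor.

(** * Convergence of the coefficients of Jensen polynomials *)

Section JensenLimits.
Variable R : realType.
Local Notation C := R[i].

Lemma cvg_ffact_ratio k :
  (fun M : nat => (M.+1 ^_ k)%:R / M.+1%:R ^+ k : R) @ \oo --> (1 : R).
Proof.
elim: k => [|k IH].
  under eq_fun do rewrite ffactn0 expr0 divr1.
  exact: cvg_cst.
have h : (fun M : nat => 1 - k%:R * M.+1%:R^-1 : R) @ \oo --> (1 : R).
  rewrite -[X in _ --> X]subr0 -(mulr0 k%:R).
  exact: (cvgB (cvg_cst (1 : R)) (cvgM (cvg_cst (k%:R : R)) (@cvg_harmonic R))).
have hh : (fun M : nat => (M.+1 ^_ k)%:R / M.+1%:R ^+ k * (1 - k%:R * M.+1%:R^-1) : R)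
    @ \oo --> (1 * 1 : R) by exact: (cvgM IH h).
rewrite mulr1 in hh.
apply: cvgr_ext hh; near=> M.
have kM : (k <= M.+1)%N by near: M; exists k => // n /= kn; exact: leqW.
rewrite ffactnSr natrM natrB // exprSr /=.
have M0 : M.+1%:R != 0 :> R by rewrite pnatr_eq0.
by field; rewrite expf_neq0 // andbT nat1r M0.
Unshelve. all: by end_near.
Qed.

Lemma cvg_jensen_coef (F : nat -> R) k : (fun M => (jensen F M.+1)`_k) @ \oo --> F k.
Proof.
have h : (fun M : nat => F k * ((M.+1 ^_ k)%:R / M.+1%:R ^+ k)) @ \oo --> F k * 1.
  exact: (cvgM (cvg_cst (F k)) (@cvg_ffact_ratio k)).
rewrite mulr1 in h.
apply: cvgr_ext h; near=> M.
rewrite coef_poly; have -> : (k < M.+2)%N by near: M; exists k => // n /= kn; rewrite ltnS leqW.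
by rewrite mulrA.
Unshelve. all: by end_near.
Qed.

Lemma Re_sum I (r : seq I) (f : I -> C) :
  complex.Re (\sum_(i <- r) f i) = \sum_(i <- r) complex.Re (f i).
Proof. by apply: (big_morph (@complex.Re R)) => // -[a b] [c d]. Qed.

End JensenLimits.

(** * Limits of Jensen polynomials with asymptotically real roots *)

Section JensenClosure.
Variables (R : realType) (mu : R) (F : nat -> R) (al : nat -> seq R[i]).
Local Notation C := R[i].
Local Notation toC := (real_complex R).
Hypothesis F0 : F 0%N != 0.
Hypothesis size_al : forall M, size (al M) = M.+1.
Hypothesis Im_al : forall M a, a \in al M -> `|complex.Im a| <= mu / M.+1%:R.
Hypothesis jensen_al : forall M,
  map_poly toC (jensen F M.+1) = (F 0%N)%:C *: \prod_(a <- al M) (1 + a *: 'X).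
Hypothesis sorted_al : forall M, sorted (fun x y : C => nm y <= nm x) (al M).

(** [s] and [T M] are the first two power sums of [al M], read off the coefficients; 1 - 1/N is N^_2
    / N^2 with N = M+1. [A] bounds sum |a|^2 = T M + 2 sum (Im a)^2. *)
Let s := F 1%N / F 0%N.
Let T M := s ^+ 2 - 2 * (F 2%N / F 0%N) * (1 - M.+1%:R^-1).
Let A := s ^+ 2 + 2 * `|F 2%N / F 0%N| + 2 * mu ^+ 2.

Lemma sum_jensen_roots M : \sum_(a <- al M) a = s%:C.
Proof.
have := congr1 (fun p : {poly C} => p`_1) (jensen_al M).
rewrite coef_map coef_poly coefZ; case: (coef_prod_linear (al M)) => _ -> _.
rewrite /= ffactn1 expr1 mulfK ?pnatr_eq0 // => e.
apply: (mulfI (_ : (F 0%N)%:C != 0)); first by rewrite fmorph_eq0.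
by rewrite -e -rmorphM /s mulrC divfK.
Qed.

Lemma sum_sqr_jensen_roots M : \sum_(a <- al M) a ^+ 2 = (T M)%:C.
Proof.
have := congr1 (fun p : {poly C} => 2 * p`_2) (jensen_al M).
rewrite coef_map coef_poly coefZ mulrCA; case: (coef_prod_linear (al M)) => _ _ ->.
rewrite sum_jensen_roots => e.
have FC : (F 0%N)%:C != 0 :> C by rewrite fmorph_eq0.
have M0 : M.+1%:R != 0 :> R by rewrite pnatr_eq0.
(* For M = 0 the coefficient lies beyond the truncation, in agreement with 1 - 1/(M+1) = 0. *)
have c2 : (if (2 < M.+2)%N then F 2%N * (M.+1 ^_ 2)%:R / M.+1%:R ^+ 2 else 0) =
    F 2%N * (1 - M.+1%:R^-1).
  case: ifPn => [_|]; last by case: (M) => // _; rewrite invr1 subrr mulr0.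
  rewrite ffactnSr ffactn1 subn1 natrM -mulrA; congr (_ * _).
  by rewrite -[M.+1.-1]/M -(addrK 1 M%:R) natr1; field.
move: e; rewrite c2 /= => e.
apply: (mulfI FC); apply/eqP; rewrite -subr_eq0 -oppr_eq0; apply/eqP.
transitivity ((F 0%N)%:C * (s%:C ^+ 2 - \sum_(a <- al M) a ^+ 2) - (F 0%N)%:C * (s%:C ^+ 2 - (T M)%:C)).
  by ring.
rewrite -e -!rmorphXn -!rmorphB -!rmorphM -(rmorph_nat toC) -rmorphM -rmorphB.
apply/eqP; rewrite fmorph_eq0; apply/eqP; rewrite /T; field.
by rewrite F0 -?nat1r; move: M0; rewrite -nat1r => ->.
Qed.

Lemma sum_sqr_Im_jensen_roots M : \sum_(a <- al M) complex.Im a ^+ 2 <= mu ^+ 2 / M.+1%:R.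
Proof.
have M0 : M.+1%:R != 0 :> R by rewrite pnatr_eq0.
apply: (@le_trans _ _ (\sum_(a <- al M) (mu / M.+1%:R) ^+ 2)).
  rewrite big_seq [leRHS]big_seq; apply: ler_sum => a aM.
  rewrite -real_normK ?num_real // lerXn2r ?nnegrE ?Im_al //.
  exact: le_trans (Im_al aM).
rewrite big_const_seq count_predT size_al iter_addr_0 -mulr_natr.
rewrite le_eqVlt; apply/orP; left; apply/eqP; rewrite expr_div_n; field.
by move: M0; rewrite -nat1r.
Qed.

Lemma sum_sqr_Re_jensen_roots M :
  \sum_(a <- al M) complex.Re a ^+ 2 = T M + \sum_(a <- al M) complex.Im a ^+ 2.
Proof.
have := congr1 (@complex.Re R) (sum_sqr_jensen_roots M); rewrite Re_sum /= => <-.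
rewrite -big_split; apply: eq_bigr => -[x y] _ /=; ring.
Qed.

Lemma mu2_div_le M : mu ^+ 2 / M.+1%:R <= mu ^+ 2.
Proof.
by rewrite ler_pdivrMr ?ltr0n // ler_peMr ?sqr_ge0 // ler1n.
Qed.

Lemma sum_nm_jensen_roots M : \sum_(a <- al M) nm a ^+ 2 <= A.
Proof.
under eq_bigr do rewrite nm_sqr.
rewrite big_split /= sum_sqr_Re_jensen_roots.
have := sum_sqr_Im_jensen_roots M; have := mu2_div_le M.
have : T M <= s ^+ 2 + 2 * `|F 2%N / F 0%N|.
  have i1 : M.+1%:R^-1 <= 1 :> R by rewrite invf_le1 // ler1n.
  have i0 : 0 <= M.+1%:R^-1 :> R by rewrite invr_ge0.
  rewrite /T; move: (F 2%N / F 0%N) (M.+1%:R^-1) i0 i1 => X i i0 i1.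
  have X0 := normr_ge0 X; have := ler_norm (- X); rewrite normrN; nra.
rewrite /A; move: (T M) (\sum_(i <- _) _) (mu ^+ 2 / _) `|F _ / _| => t i q f; lra.
Qed.

Lemma A_ge0 : 0 <= A.
Proof. by apply: le_trans (sum_nm_jensen_roots 0); apply: sumr_ge0 => a _; rewrite exprn_ge0 ?nm_ge0. Qed.

Lemma sub_sum_nm M J (t : seq C) : t = take J (al M) \/ t = drop J (al M) ->
  \sum_(a <- t) nm a ^+ 2 <= A.
Proof.
move=> tJ; apply: le_trans (sum_nm_jensen_roots M).
have ge0 (u : seq C) : 0 <= \sum_(a <- u) nm a ^+ 2.
  by apply: sumr_ge0 => a _; rewrite exprn_ge0 ?nm_ge0.
rewrite -[X in _ <= \sum_(_ <- X) _](cat_take_drop J) big_cat /=.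
by case: tJ => ->; rewrite ?lerDl ?lerDr ge0.
Qed.

Lemma big_take (S : Type) (idx : S) (op : Monoid.law idx) (g : C -> S) (u : seq C) J :
  (J <= size u)%N ->
  \big[op/idx]_(a <- take J u) g a = \big[op/idx]_(0 <= j < J) g u`_j.
Proof.
move=> Ju; rewrite (big_nth 0) size_takel //; apply: eq_big_nat => j /andP[_ jJ].
by rewrite nth_take.
Qed.

Lemma nm_root_antitone M i j : (i <= j)%N -> nm (al M)`_j <= nm (al M)`_i.
Proof.
move=> ij; have [Mj|jM] := leqP (size (al M)) j.
  by rewrite [_`_j]nth_default // nm0 nm_ge0.
have tr : transitive (fun x y : C => nm y <= nm x) by move=> y x z xy /le_trans; apply.
have rf : reflexive (fun x y : C => nm y <= nm x) by move=> x; exact: lexx.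
by apply: (sorted_leq_nth tr rf 0 (sorted_al M)) => //; rewrite inE (leq_ltn_trans ij).
Qed.

(* [j.+1 * nm (al M)`_j ^+ 2 <= A] since the [nm (al M)`_j] decrease. *)
Let eps J : R := Num.sqrt (A / J.+1%:R).

Lemma nm_root_le M j : nm (al M)`_j <= eps j.
Proof.
rewrite -(ler_pXn2r (n := 2)) ?nnegrE ?nm_ge0 ?sqrtr_ge0 //.
rewrite sqr_sqrtr ?divr_ge0 ?A_ge0 // ler_pdivlMr ?ltr0n //.
have [Mj|jM] := leqP (size (al M)) j.
  by rewrite nth_default // nm0 expr0n mul0r A_ge0.
apply: le_trans (@sub_sum_nm M j.+1 _ (or_introl erefl)).
rewrite (@big_take _ _ _ (fun a => nm a ^+ 2)) // big_mkord.
rewrite mulr_natr -[X in _ *+ X]card_ord -sumr_const; apply: ler_sum => i _.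
by rewrite lerXn2r ?nnegrE ?nm_ge0 // nm_root_antitone // -ltnS.
Qed.

Lemma eps_antitone i j : (i <= j)%N -> eps j <= eps i.
Proof.
move=> ij; apply: ler_wsqrtr; apply: ler_wpM2l; first exact: A_ge0.
by rewrite lef_pV2 ?posrE ?ltr0n // ler_nat ltnS.
Qed.

Lemma cvg_eps : eps @ \oo --> (0 : R).
Proof.
apply/cvgrPdist_lt => e e0.
have h : (fun n : nat => A * n.+1%:R^-1) @ \oo --> A * 0.
  exact: (cvgM (cvg_cst A) (@cvg_harmonic R)).
rewrite mulr0 in h; have /cvgrPdist_lt/(_ (e ^+ 2) (exprn_gt0 _ e0)) := h.
apply: filterS => n; rewrite !sub0r !normrN ger0_norm ?divr_ge0 ?A_ge0 //.
rewrite ger0_norm ?sqrtr_ge0 // => An.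
rewrite -(ltr_pXn2r (n := 2)) ?nnegrE ?sqrtr_ge0 ?(ltW e0) //.
by rewrite sqr_sqrtr ?divr_ge0 ?A_ge0.
Qed.

Let G M z := (map_poly toC (jensen F M.+1)).[z].

(** The factors e^(-a z) inserted for each root have product e^(-s z), which [cexp (s%:C * z)]
    compensates. In this form the value is bounded through sum |a|^2. *)
Lemma jensen_value M z :
  G M z = (F 0%N)%:C * cexp (s%:C * z) * \prod_(a <- al M) weierstrass_factor (a * z).
Proof.
rewrite /G jensen_al hornerZ horner_prod -mulrA; congr (_ * _).
rewrite /weierstrass_factor big_split /= -cexp_sum mulrCA -cexpD.
rewrite sumrN -mulr_suml sum_jensen_roots subrr cexp0 mulr1.
by apply: eq_bigr => a _; rewrite hornerD hornerC hornerZ hornerX.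
Qed.

Lemma nm_prod_weierstrass (u : seq C) z : \sum_(a <- u) nm a ^+ 2 <= A ->
  nm (\prod_(a <- u) weierstrass_factor (a * z)) <= expR (nm z ^+ 2 * A / 2).
Proof.
move=> uA; rewrite nm_prod.
apply: le_trans (_ : \prod_(a <- u) expR (nm z ^+ 2 * nm a ^+ 2 / 2) <= _).
  apply: ler_prod => a _; rewrite nm_ge0 /=; apply: le_trans (nm_weierstrass_factor _) _.
  by rewrite nmM exprMn (mulrC (nm a ^+ 2)).
rewrite -expR_sum ler_expR -mulr_suml -mulr_sumr.
by rewrite ler_pM2r ?invr_gt0 // ler_wpM2l // exprn_ge0 ?nm_ge0.
Qed.

Let bound (r : R) : R := `|F 0%N| * expR (`|s| * r) * expR (r ^+ 2 * A / 2).

Lemma jensen_bound M z : nm (G M z) <= bound (nm z).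
Proof.
rewrite jensen_value 2!nmM nm_real; apply: ler_pM; rewrite ?mulr_ge0 ?nm_ge0 //.
  by apply: ler_wpM2l => //; apply: le_trans (nm_cexp_le _) _; rewrite nmM nm_real.
exact/nm_prod_weierstrass/sum_nm_jensen_roots.
Qed.

Lemma jensen_coef_bound M k r : 0 < r -> `|(jensen F M.+1)`_k| * r ^+ k <= bound r.
Proof.
move=> r0; rewrite -nm_real -coef_map; apply: cauchy_estimate => // z <-.
exact: jensen_bound.
Qed.

Let K : R := expR 1 * (8 * expR 2 + 1).
Let const (r : R) : R := `|F 0%N| * expR (`|s| * r) * expR (r ^+ 2 * A / 2) * (expR (r ^+ 2 * A / 2) * (K * r ^+ 3 * A)).

(* The factors beyond the [J]-th, whose arguments are uniformly small, are replaced
   by the Gaussians [cexp (- (a z)^2 / 2)]. *)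
Lemma jensen_truncation M J z : (J <= M)%N -> eps J * nm z <= 1 ->
  nm (G M z - (F 0%N)%:C * cexp (s%:C * z) *
      \prod_(0 <= j < J) weierstrass_factor ((al M)`_j * z) *
      cexp (- (z ^+ 2 / 2 * ((T M)%:C - \sum_(0 <= j < J) (al M)`_j ^+ 2)))) <=
  const (nm z) * eps J.
Proof.
move=> JM epsz; have Js : (J <= size (al M))%N by rewrite size_al leqW.
have K0 : 0 <= K by rewrite mulr_ge0 ?addr_ge0 ?mulr_ge0 ?expR_ge0.
have z0 := nm_ge0 z.
rewrite jensen_value -[X in \prod_(_ <- X) _](cat_take_drop J) big_cat /=.
rewrite -(@big_take _ _ _ (fun a => weierstrass_factor (a * z))) //.
(* The tail enters only through its sum of squares, the total minus the first J terms; this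
   converges with M although no tail root is followed individually. *)
have -> : (T M)%:C - \sum_(0 <= j < J) (al M)`_j ^+ 2 = \sum_(a <- drop J (al M)) a ^+ 2.
  rewrite -sum_sqr_jensen_roots -[X in \sum_(_ <- X) _](cat_take_drop J) big_cat /=.
  by rewrite (@big_take _ _ _ (fun a => a ^+ 2)) // addrAC subrr add0r.
have -> : cexp (- (z ^+ 2 / 2 * \sum_(a <- drop J (al M)) a ^+ 2)) =
   \prod_(a <- drop J (al M)) cexp (- ((a * z) ^+ 2 / 2)).
  rewrite -cexp_sum; congr cexp; rewrite mulr_sumr -sumrN; apply: eq_bigr => a _.
  by rewrite exprMn; ring.
have hP := nm_prod_weierstrass z (@sub_sum_nm M J _ (or_introl erefl)).
have hQ : nm ((F 0%N)%:C * cexp (s%:C * z)) <= `|F 0%N| * expR (`|s| * nm z).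
  rewrite nmM nm_real; apply: ler_wpM2l => //.
  by apply: le_trans (nm_cexp_le _) _; rewrite nmM nm_real.
have dA := @sub_sum_nm M J _ (or_intror erefl).
have h := @nm_prod_sub R _ (drop J (al M)) (fun a => weierstrass_factor (a * z))
  (fun a => cexp (- ((a * z) ^+ 2 / 2))) (fun a => nm (a * z) ^+ 2 / 2)
  (fun a => nm_weierstrass_factor _) (fun a => nm_gaussian _).
rewrite mulrA -mulrBr nmM nmM /const -[leRHS]mulrA.
apply: ler_pM; rewrite ?mulr_ge0 ?nm_ge0 //.
  by apply: ler_pM; rewrite ?nm_ge0.
apply: le_trans (h _) _ => [a|]; first by rewrite divr_ge0 ?exprn_ge0 ?nm_ge0.
rewrite -[leRHS]mulrA; apply: ler_pM; rewrite ?expR_ge0 ?sumr_ge0 //.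
- by move=> a _; exact: nm_ge0.
- rewrite ler_expR; under eq_bigr do rewrite nmM exprMn.
  by rewrite -!mulr_suml; have := ler_wpM2r (exprn_ge0 2 z0) dA; lra.
(* Of the cubic error |a z|^3 one factor |a| is absorbed into [eps J]; the remaining |a|^2 sum to at
   most [A]. *)
apply: le_trans (_ : \sum_(a <- drop J (al M)) K * nm z ^+ 3 * eps J * nm a ^+ 2 <= _); last first.
  rewrite -mulr_sumr [leRHS]mulrAC; apply: ler_wpM2l => //.
  by rewrite !mulr_ge0 ?exprn_ge0 ?sqrtr_ge0.
rewrite big_seq [leRHS]big_seq; apply: ler_sum => a aJ.
have aeps : nm a <= eps J.
  have /(nthP 0)[i _ <-] := aJ; rewrite nth_drop.
  by apply: le_trans (nm_root_le _ _) (eps_antitone (leq_addr _ _)).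
have az1 : nm (a * z) <= 1 by rewrite nmM; apply: le_trans epsz; rewrite ler_wpM2r.
apply: le_trans (weierstrass_factor_gaussian az1) _; rewrite nmM -/K.
have -> : K * nm z ^+ 3 * eps J * nm a ^+ 2 = K * nm z ^+ 3 * (nm a ^+ 2) * eps J by rewrite mulrAC.
have -> : K * (nm a * nm z) ^+ 3 = K * nm z ^+ 3 * (nm a ^+ 2) * nm a.
  by move: K (nm a) (nm z) => *; ring.
by apply: ler_wpM2l; rewrite ?mulr_ge0 ?exprn_ge0 ?nm_ge0.
Qed.

Let Tlim : R := s ^+ 2 - 2 * (F 2%N / F 0%N).

Lemma cvg_T : T @ \oo --> Tlim.
Proof.
have h : (fun M => T M) @ \oo --> s ^+ 2 - 2 * (F 2%N / F 0%N) * (1 - 0).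
  apply: (cvgB (cvg_cst (s ^+ 2))); apply: (cvgM (cvg_cst (2 * (F 2%N / F 0%N)))).
  exact: (cvgB (cvg_cst (1 : R)) (@cvg_harmonic R)).
by rewrite subr0 mulr1 in h.
Qed.

Section Ultrafilter.
Variable U : set_system nat.
Hypothesis UU : UltraFilter U.
Hypothesis sU : \oo `<=` U.

Lemma near_ge J : \forall M \near U, (J <= M)%N.
Proof. by apply: sU; exists J. Qed.

Lemma cvg_ultra (u : nat -> R) (l : R) : u @ \oo --> l -> u @ U --> l.
Proof. by move=> h B /h hB; exact: sU. Qed.

(** The real part converges along [U] by compactness and the imaginary part is at most |mu|/(M+1),
    so the limit is real. *)
Lemma jensen_root_limit j : exists x : R,
  (fun M => complex.Re (al M)`_j) @ U --> x /\ ccvg U (fun M => (al M)`_j) x%:C.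
Proof.
have [x ux] : exists x : R, (fun M => complex.Re (al M)`_j) @ U --> x.
  by apply: (@ultra_cvg_real _ _ _ UU _ (eps j)) => M; apply: le_trans (Re_le_nm _) (nm_root_le _ _).
exists x; split=> //.
have ImM M : `|complex.Im (al M)`_j| <= `|mu| * M.+1%:R^-1.
  have [Mj|jM] := leqP (size (al M)) j.
    by rewrite nth_default //= normr0 mulr_ge0 // invr_ge0.
  apply: le_trans (Im_al (mem_nth 0 jM)) _.
  by apply: ler_wpM2r; rewrite ?invr_ge0 // ler_norm.
have h : (fun M => `|complex.Re (al M)`_j - x| + `|mu| * M.+1%:R^-1) @ U --> 0 + `|mu| * 0.
  apply: cvgD.
    rewrite -(normr0 R) -(subrr x); apply: (@cvg_norm _ R).
    exact: (cvgB ux (cvg_cst x)).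
  exact: (cvgM (cvg_cst `|mu|) (cvg_ultra (@cvg_harmonic R))).
rewrite mulr0 addr0 in h; apply: ccvg_squeeze h; apply: nearW => M.
apply: le_trans (nm_le_ReIm _) _; apply: lerD.
  by case: (_`_j) => p q /=.
by apply: le_trans (ImM M); case: (_`_j) => p q /=; rewrite subr0.
Qed.

Lemma jensen_value_limit z : exists l : C, ccvg U (fun M => G M z) l.
Proof. by apply: (@ultra_cvg_complex _ _ _ UU _ (bound (nm z))) => M; exact: jensen_bound. Qed.

Variables (x : nat -> R) (phi : C -> C).
Hypothesis Re_lim : forall j, (fun M => complex.Re (al M)`_j) @ U --> x j.
Hypothesis root_lim : forall j, ccvg U (fun M => (al M)`_j) (x j)%:C.
Hypothesis value_lim : forall z, ccvg U (fun M => G M z) (phi z).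

Lemma root_limit_antitone i j : (i <= j)%N -> `|x j| <= `|x i|.
Proof.
move=> ij; apply/ler_addgt0Pr => e e0; have e2 : 0 < e / 2 by rewrite divr_gt0.
have [M [hi hj]] := filter_ex (filterI (root_lim i e2) (root_lim j e2)).
have := nm_root_antitone M ij; rewrite -!nm_real.
have := nmD ((x j)%:C - (al M)`_j) (al M)`_j; rewrite subrK.
have := nmD ((al M)`_i - (x i)%:C) (x i)%:C; rewrite subrK.
by have := nmB (x j)%:C (al M)`_j; lra.
Qed.

(** A Fatou inequality: n squares are dominated by the sum over all roots, at most T M + mu^2/(M+1),
    which tends to [Tlim]. It yields both summability and the sign of the Gaussian exponent. *)
Lemma sum_sqr_root_limit n : \sum_(0 <= k < n) x k ^+ 2 <= Tlim.
Proof.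
have h1 : (fun M => \sum_(0 <= k < n) complex.Re (al M)`_k ^+ 2) @ U --> \sum_(0 <= k < n) x k ^+ 2.
  apply: ccvg_realP; rewrite rmorph_sum.
  apply: ccvg_ext (_ : ccvg U (fun M => \sum_(0 <= k < n) (complex.Re (al M)`_k ^+ 2)%:C) _).
    by apply: nearW => M; rewrite rmorph_sum.
  apply: ccvg_sum => k _; apply: ccvg_real.
  have h : (fun M => complex.Re (al M)`_k * complex.Re (al M)`_k) @ U --> x k * x k.
    exact: (cvgM (@Re_lim k) (@Re_lim k)).
  by rewrite expr2; apply: cvgr_ext h; apply: nearW => M; rewrite expr2.
have h2 : (fun M => T M + mu ^+ 2 * M.+1%:R^-1) @ U --> Tlim + mu ^+ 2 * 0.
  apply: cvgD; first exact: (cvg_ultra cvg_T).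
  exact: (cvgM (cvg_cst (mu ^+ 2)) (cvg_ultra (@cvg_harmonic R))).
rewrite mulr0 addr0 in h2; apply: ler_cvg_to h1 h2 _.
apply: filterS (near_ge n) => M nM.
have nM' : (n <= size (al M))%N by rewrite size_al leqW.
rewrite -(@big_take _ _ _ (fun a => complex.Re a ^+ 2)) //.
apply: le_trans (_ : \sum_(a <- al M) complex.Re a ^+ 2 <= _).
  rewrite -[X in _ <= \sum_(_ <- X) _](cat_take_drop n) big_cat /= lerDl.
  by apply: sumr_ge0 => a _; rewrite sqr_ge0.
by rewrite sum_sqr_Re_jensen_roots lerD2l sum_sqr_Im_jensen_roots.
Qed.

(** The tails of the Jensen polynomials are geometrically small uniformly in M, so the limits in M
    and in the truncation rank may be exchanged. *)
Lemma sums_to_jensen_limit : sums_to F phi.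
Proof.
(* |z| <= r/2 produces the ratio 1/2, and the added 1 keeps r positive at z = 0. *)
apply/sums_toP => z; pose r := 2 * (nm z + 1).
have r0 : 0 < r by rewrite mulr_gt0 // ltr_pwDr // nm_ge0.
have tail M n : nm (G M z - psum (fun k => (jensen F M.+1)`_k) z n) <= 2 * bound r / 2 ^+ n.
  apply: sums_to_tail (@sums_to_poly _ (jensen F M.+1)) _ => k _.
  rewrite ler_pdivlMr ?exprn_gt0 //; apply: le_trans (jensen_coef_bound M k r0).
  rewrite -mulrA; apply: ler_wpM2l => //; rewrite -exprMn mulrC.
  apply: lerXn2r; rewrite ?nnegrE; [by rewrite mulr_ge0 ?nm_ge0|exact: ltW|].
  by rewrite ler_pM2l // lerDl.
have h : (fun n => 2 * bound r * (1 / 2) ^+ n) @ \oo --> 2 * bound r * 0.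
  apply: (cvgM (cvg_cst _)); apply: cvg_expr; rewrite ger0_norm; lra.
rewrite mulr0 in h; apply: ccvg_squeeze h; apply: nearW => n.
rewrite nmB expr_div_n expr1n mul1r.
have hp : ccvg U (fun M => psum (fun k => (jensen F M.+1)`_k) z n) (psum F z n).
  apply: ccvg_sum => k _; apply: ccvgM; last exact: ccvg_cst.
  by apply: ccvg_real; apply: cvg_ultra; exact: cvg_jensen_coef.
by apply: (ccvg_nm_le (ccvgB (value_lim z) hp)); apply: nearW => M; exact: tail.
Qed.

(** In [jensen_truncation], M tends to infinity along [U] for fixed J; the error
    [const (nm z) * eps J] does not depend on M and vanishes as J grows. *)
Lemma cvg_truncated_product z :
  ccvg \oo (fun J => (F 0%N)%:C * cexp (s%:C * z) *
      \prod_(0 <= j < J) weierstrass_factor ((x j)%:C * z) *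
      cexp (- (z ^+ 2 / 2 * (Tlim%:C - \sum_(0 <= j < J) (x j)%:C ^+ 2)))) (phi z).
Proof.
have h : (fun J => const (nm z) * eps J) @ \oo --> const (nm z) * 0.
  exact: (cvgM (cvg_cst _) cvg_eps).
rewrite mulr0 in h; apply: ccvg_squeeze h.
have z1 : 0 < nm z + 1 by rewrite ltr_pwDr // nm_ge0.
have e0 : 0 < (nm z + 1)^-1 by rewrite invr_gt0.
have /cvgrPdist_lt/(_ _ e0) := cvg_eps; apply: filterS => J.
rewrite sub0r normrN ger0_norm ?sqrtr_ge0 // => epsJ.
have epsz : eps J * nm z <= 1.
  have : eps J * (nm z + 1) <= 1 by rewrite -ler_pdivlMr // mul1r ltW.
  by have := sqrtr_ge0 (A / J.+1%:R); rewrite -/(eps J); lra.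
have hm : ccvg U (fun M => (F 0%N)%:C * cexp (s%:C * z) *
      \prod_(0 <= j < J) weierstrass_factor ((al M)`_j * z) *
      cexp (- (z ^+ 2 / 2 * ((T M)%:C - \sum_(0 <= j < J) (al M)`_j ^+ 2))))
    ((F 0%N)%:C * cexp (s%:C * z) *
      \prod_(0 <= j < J) weierstrass_factor ((x j)%:C * z) *
      cexp (- (z ^+ 2 / 2 * (Tlim%:C - \sum_(0 <= j < J) (x j)%:C ^+ 2)))).
  apply: ccvgM.
    apply: ccvgM; first exact: ccvg_cst.
    apply: ccvg_prod => j _; apply: ccvg_weierstrass_factor.
    by apply: ccvgM; [exact: root_lim|exact: ccvg_cst].
  apply: ccvg_cexp; apply: ccvgN; apply: ccvgM; first exact: ccvg_cst.
  apply: ccvgB; first by apply: ccvg_real; exact: cvg_ultra cvg_T.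
  by apply: ccvg_sum => j _; apply: ccvgX; exact: root_lim.
rewrite nmB; apply: (ccvg_nm_le (ccvgB (value_lim z) hm)).
by apply: filterS (near_ge J) => M JM; exact: jensen_truncation.
Qed.

(* The mass [Tlim - \sum x_k^2] lost by the squares of the roots in the limit is
   what produces the factor [cexp (- a z^2)]. *)
Lemma jensen_limit_product : exists2 a : R, 0 <= a & forall z,
  ccvg \oo (fun n => (F 0%N)%:C * cexp (- a%:C * z ^+ 2 + s%:C * z) *
    \prod_(0 <= k < n) weierstrass_factor ((x k)%:C * z)) (phi z).
Proof.
pose S n := \sum_(0 <= k < n) x k ^+ 2.
have Snd : nondecreasing_seq S.
  move=> p q pq; rewrite /S [leRHS](big_cat_nat (n := p)) //= lerDl sumr_ge0 // => k _.
  exact: sqr_ge0.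
have Sc : cvgn S.
  apply: nondecreasing_is_cvgn => //; exists Tlim => _ [n _ <-].
  exact: sum_sqr_root_limit.
pose a := (Tlim - limn S) / 2.
have a0 : 0 <= a.
  rewrite divr_ge0 // subr_ge0; apply: limr_le => //.
  by apply: nearW => n; exact: sum_sqr_root_limit.
exists a => // z; rewrite -[phi z]mulr1.
(* A factor tending to 1, which replaces the varying S n in the Gaussian exponent by its limit. *)
have hS : ccvg \oo (fun n => cexp (z ^+ 2 / 2 * ((limn S)%:C - (S n)%:C)))
    (cexp (z ^+ 2 / 2 * ((limn S)%:C - (limn S)%:C))).
  apply: ccvg_cexp; apply: ccvgM; first exact: ccvg_cst.
  apply: ccvgB; first exact: ccvg_cst.
  by apply: ccvg_real; exact: Sc.
rewrite subrr mulr0 cexp0 in hS.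
apply: ccvg_ext (ccvgM (cvg_truncated_product z) hS); apply: nearW => n.
have SE : (S n)%:C = \sum_(0 <= j < n) (x j)%:C ^+ 2.
  by rewrite rmorph_sum; apply: eq_bigr => j _; rewrite rmorphXn.
have -> : - a%:C * z ^+ 2 + s%:C * z = s%:C * z + - (z ^+ 2 / 2 * (Tlim%:C - (S n)%:C)) +
    z ^+ 2 / 2 * ((limn S)%:C - (S n)%:C).
  by rewrite /a rmorphM fmorphV rmorphB rmorph_nat; field.
rewrite !cexpD -SE; move: (cexp _) (cexp _) (cexp _) (\prod_(0 <= k < n) _) => p q t w; ring.
Qed.

End Ultrafilter.

Lemma jensen_closure : exists (a b : R) (x : nat -> R) (phi : C -> C),
  [/\ 0 <= a, forall i j, (i <= j)%N -> `|x j| <= `|x i|,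
      exists S, forall n, \sum_(0 <= k < n) x k ^+ 2 <= S,
      sums_to F phi &
      forall z, ccvg \oo (fun n => (F 0%N)%:C * cexp (- a%:C * z ^+ 2 + b%:C * z) *
        \prod_(0 <= k < n) weierstrass_factor ((x k)%:C * z)) (phi z)].
Proof.
have [U [UU sU]] := @ultraFilterLemma nat \oo _.
have [x hx] := choice (jensen_root_limit UU sU).
have [phi hphi] := choice (jensen_value_limit UU).
have hx1 j := (hx j).1; have hx2 j := (hx j).2.
have [a a0 ha] := jensen_limit_product UU sU hx1 hx2 hphi.
exists a, s, x, phi; split=> //.
- exact: (root_limit_antitone UU hx2).
- by exists Tlim => n; exact: (sum_sqr_root_limit UU sU hx1).
- exact: (sums_to_jensen_limit UU sU hphi).
Qed.

End JensenClosure.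

(** * From the limit product to the Laguerre-Polya form *)

Section StripPreserverIsLaguerrePolya.
Variable R : realType.
Local Notation C := R[i].

(** Once a limit is 0 all later ones are, so the nonzero limits occupy an initial segment of the
    indices. The ordering of the roots by modulus is what provides this. *)
Lemma antitone_support (x : nat -> R) : (forall i j, (i <= j)%N -> `|x j| <= `|x i|) ->
  exists omega, forall k, below omega k = (x k != 0).
Proof.
move=> xle; have [[k0 xk0]|none] := pselect (exists k, x k == 0); last first.
  by exists None => k; apply/esym/negP => xk; apply: none; exists k.
have ex : exists k, x k == 0 by exists k0.
case: (ex_minnP ex) => k1 xk1 min; exists (Some k1) => k /=.
rewrite ltnNge; congr negb; apply/idP/idP => [/xle|/min] //.
by rewrite (eqP xk1) normr0 normr_le0.
Qed.

Lemma sums_to_shift (f : nat -> R) m (phi : C -> C) : (forall k, (k < m)%N -> f k = 0) ->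
  sums_to (fun k => f (m + k)%N) phi -> sums_to f (fun z => z ^+ m * phi z).
Proof.
move=> f0 /sums_toP h; apply/sums_toP => z.
have hz : ccvg \oo (fun n => z ^+ m * psum (fun k => f (m + k)%N) z n) (z ^+ m * phi z).
  by apply: ccvgM; [exact: ccvg_cst|exact: h].
move=> e e0; have [N _ hN] := hz e e0; exists (m + N)%N => // n /= mNn.
have mn : (m <= n)%N by apply: leq_trans mNn; rewrite leq_addr.
have -> : psum f z n = z ^+ m * psum (fun k => f (m + k)%N) z (n - m).
  rewrite /psum (big_cat_nat (n := m)) //= big_nat_cond big1 ?add0r => [|k]; last first.
    by rewrite andbT => /andP[_ km]; rewrite f0 // mul0r.
  rewrite -{1}(add0n m) big_addn mulr_sumr; apply: eq_bigr => k _.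
  by rewrite addnC exprD mulrCA.
by apply: hN; rewrite /= leq_subRL.
Qed.

Lemma zero_Laguerre_Polya (f : nat -> R) : (forall k, f k = 0) -> in_Laguerre_Polya f.
Proof.
move=> f0; have s0 : sums_to f (fun=> 0 : C).
  apply/sums_toP => z; apply: ccvg_ext (ccvg_cst _); apply: nearW => n.
  by rewrite /psum big1 // => k _; rewrite f0 mul0r.
exists (fun=> 0) => //; split; first by exists f.
exists 0, 0, 0, 0%N, (Some 0%N), (fun=> 0); split=> // [|z].
  by under eq_fun do rewrite big_pred0 //; exact: is_cvg_cst.
apply/cvg_ccvgP; apply: ccvg_ext (ccvg_cst _); apply: nearW => n.
by rewrite !mul0r.
Qed.

Lemma strip_preserving_Laguerre_Polya (mu : R) (f : nat -> R) : 0 <= mu ->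
  series_of_D f @` strip_poly mu `<=` strip_poly mu `|` [set 0] -> in_Laguerre_Polya f.
Proof.
move=> mu0 hf; have [ex|none] := pselect (exists k, f k != 0); last first.
  by apply: zero_Laguerre_Polya => k; apply/eqP; apply: contra_notT none => fk; exists k.
case: (ex_minnP ex) => m fm min.
have f0 k : (k < m)%N -> f k = 0.
  by move=> km; apply/eqP; apply: contraTT km => /min; rewrite -leqNgt.
(* The test polynomials are powers of X: their only root 0 lies in the strip because 0 <= mu. *)
have Xn M : (strip_poly mu `|` [set 0]) (series_of_D f ('X^(m + M.+1) : {poly C})).
  apply: hf; exists 'X^(m + M.+1) => //; split; first by rewrite -size_poly_gt0 size_polyXn.
  move=> z; rewrite rootE hornerXn expf_eq0 => /andP[_ /eqP ->].
  by rewrite normr0.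
have [al0 hal0] := choice (fun M => jensen_roots (Xn M) f0 fm).
pose ge := fun x y : C => nm y <= nm x.
pose al M := sort ge (al0 M).
have pal M : perm_eq (al M) (al0 M) by rewrite perm_sort.
have size_al M : size (al M) = M.+1 by rewrite size_sort; case: (hal0 M).
have Im_al M a : a \in al M -> `|complex.Im a| <= mu / M.+1%:R.
  by rewrite mem_sort; case: (hal0 M) => _ h _ /h.
have jensen_al M : map_poly (real_complex R) (jensen (fun k => f (m + k)%N) M.+1) =
    (f (m + 0)%N)%:C *: \prod_(a <- al M) (1 + a *: 'X).
  by rewrite (perm_big _ (pal M)) addn0; case: (hal0 M).
have sorted_al M : sorted ge (al M).
  by apply: sort_sorted => x y; exact: le_total.
have fm0 : f (m + 0)%N != 0 by rewrite addn0.
have [a [b [x [phi [a0 xle [S hS] Fphi hphi]]]]] :=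
  jensen_closure fm0 size_al Im_al jensen_al sorted_al.
have [omega hom] := antitone_support xle.
have sphi := sums_to_shift f0 Fphi.
exists (fun z => z ^+ m * phi z) => //; split; first by exists f.
(* The limits x k are the reciprocals of the required numbers. Indices with x k = 0 fall outside
   [omega], and their Weierstrass factor is 1. *)
exists (f m), a, b, m, omega, (fun k => (x k)^-1); split; first exact: a0.
- by move=> k; rewrite hom invr_eq0.
- rewrite (_ : (fun n => _) = (fun n => \sum_(0 <= k < n) x k ^+ 2)); last first.
    apply/funext => n; rewrite big_mkcond; apply: eq_bigr => k _; rewrite hom exprVn invrK.
    by case: eqP => // ->; rewrite expr0n.
  apply: nondecreasing_is_cvgn.
    move=> p q pq; rewrite [leRHS](big_cat_nat (n := p)) //= lerDl sumr_ge0 // => k _.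
    exact: sqr_ge0.
  by exists S => _ [n _ <-]; exact: hS.
- move=> z; apply/cvg_ccvgP.
  apply: ccvg_ext (ccvgM (ccvg_cst (z ^+ m)) (hphi z)); apply: nearW => n.
  rewrite addn0 [in RHS]big_mkcond /=.
  have -> : \prod_(0 <= k < n) weierstrass_factor ((x k)%:C * z) =
     \prod_(0 <= k < n) (if below omega k then (1 + z / (x k)^-1%:C) * cexp (- (z / (x k)^-1%:C)) else 1).
    apply: eq_bigr => k _; rewrite hom fmorphV invrK (mulrC _ z).
    by case: eqP => // ->; rewrite /weierstrass_factor mulr0 oppr0 cexp0 addr0 mulr1.
  by ring.
Qed.

End StripPreserverIsLaguerrePolya.

Theorem corollary2p7 (R : realType) (mu : R) (hmu : 0 <= mu) (f : nat -> R) :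
  series_of_D f @` strip_poly mu `<=` strip_poly mu `|` [set 0] <->
  in_Laguerre_Polya f.
Proof.
split=> [|/(@Laguerre_Polya_preserves R mu) h _ [p Wp <-]].
  exact: strip_preserving_Laguerre_Polya.
by apply: h; left.
Qed.
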